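(* Let $A_1A_2A_3$ be an isosceles triangle in $\mathbb{R}^2$ with $A_1A_2=A_1A_3=a$, let $w_1=1$ and $w_2=w_3>0$, let $A_4$ be the midpoint of $A_2A_3$, put $\phi(0)=\angle A_4A_1A_3$, and assume $\phi(0)<\tfrac12\arccos\left(\frac{1}{2w_2^2}-1\right)$. Let $O$ be the weighted Fermat-Torricelli point of $\triangle A_1A_2A_3$ with weights $w_1,w_2,w_3$. Consider the frictionless mechanical system in which a knot of mass $m_0>0$ is pulled towards $A_1,A_2,A_3$ by strings exerting forces of constant magnitudes $w_1,w_2,w_3$ and is released from $A_1$ at time $0$ with zero velocity. Then the solution of this mechanical system is an oscillatory Fermat-Torricelli tree, described by the motion of the knot along the line $A_1O$: the knot reaches $O$ after some time $t_0>0$ (the time of its first arrival at $O$), and its velocity there is nonzero and given by $$\dot{x}(t_0)=\sqrt{\frac{2}{m_0}\left(2aw_2-x(t_0)-\frac{2aw_2\sin\phi(0)}{\sin(\angle A_4OA_3)}\right)},$$ where $x(t)=A_1S$ is the distance from $A_1$ to the position $S$ of the knot at time $t$.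
   Context: The weighted Fermat-Torricelli point of $\triangle A_1A_2A_3$ with positive weights $w_1,w_2,w_3$ is the unique point $O\in\mathbb{R}^2$ minimizing $P\mapsto\sum_{i=1}^3 w_i\,|PA_i|$. Under the stated angle assumption it lies on the height $A_1A_4$ with $O\neq A_1$. Mechanical system: three holes are drilled in a horizontal board at $A_1,A_2,A_3$; three strings tied together in a knot of mass $m_0$ pass through the holes, with physical weights $w_1,w_2,w_3$ attached to their loose ends. Friction is neglected, and the string through $A_i$ exerts on the knot a force of constant magnitude $w_i$ directed towards $A_i$. Thus the position $P(t)\in\mathbb{R}^2$ of the knot is a twice continuously differentiable function of $t\ge 0$ with $m_0\ddot P=\sum_{i=1}^3 w_i\vec u(P,A_i)$, $P(0)=A_1$, $\dot P(0)=0$, where $\vec u(P,A_i)$ is the unit vector from $P$ to $A_i$. When the knot is at $A_1$, where $\vec u(P,A_1)$ is undefined, the force of the first string is taken as its limit along the segment $A_1O$, i.e. of magnitude $w_1=1$ in the direction from $O$ to $A_1$. On the line $A_1O$, at a position $S$, the net force in the direction from $A_1$ to $O$ is $2w_2\cos\phi-1$, where $\phi$ is the angle at $S$ between the direction from $A_1$ to $O$ and the ray $SA_3$. The motion of the knot of this mechanical system is called an oscillatory Fermat-Torricelli tree (by definition). *)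

(* Defs.v *)
(* Stdlib reals with Coquelicot. *)
From Stdlib Require Import Reals.
From Coquelicot Require Import Coquelicot.
Open Scope R_scope.

(** Coquelicot's norm on the product [R * R] is
    [sqrt (norm (fst u) ^ 2 + norm (snd u) ^ 2)], i.e. the Euclidean norm. *)
Notation point := (R * R)%type (only parsing).

Definition eucl_dist (P Q : point) : R := norm (minus Q P).

Definition dot (u v : point) : R := fst u * fst v + snd u * snd v.

(** The angle at the middle argument; meaningful when [B <> A] and [C <> A]. *)
Definition angle (B A C : point) : R :=
  acos (dot (minus B A) (minus C A) / (eucl_dist A B * eucl_dist A C)).

Definition midpoint (P Q : point) : point := scal (/ 2) (plus P Q).

Definition collinear (A B C : point) : Prop :=
  (fst B - fst A) * (snd C - snd A) - (snd B - snd A) * (fst C - fst A) = 0.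

Definition weighted_dist_sum (A1 A2 A3 : point) (w1 w2 w3 : R) (P : point) : R :=
  w1 * eucl_dist P A1 + w2 * eucl_dist P A2 + w3 * eucl_dist P A3.

Definition is_weighted_FT_point (A1 A2 A3 : point) (w1 w2 w3 : R) (O : point) : Prop :=
  unique
    (fun Q => forall P : point,
       weighted_dist_sum A1 A2 A3 w1 w2 w3 Q <= weighted_dist_sum A1 A2 A3 w1 w2 w3 P)
    O.

(** The unit vector from [P] to [A]; meaningful when [P <> A]. *)
Definition unit_vector (P A : point) : point := scal (/ eucl_dist P A) (minus A P).

(** Direction of the pull of the first string. At [P = A1], where the unit vector
    is undefined, it is the limit of that vector along the segment from [O] to [A1]. *)
Definition first_string_direction (A1 O P : point) : point :=
  if Req_dec_T (eucl_dist P A1) 0 then unit_vector O A1 else unit_vector P A1.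

(** [f'] is the derivative of [f] on the closed half-line [0 <= t], one-sided at [0]. *)
Definition is_derivative_nonneg (f f' : R -> point) : Prop :=
  forall t : R, 0 <= t ->
    filterdiff f (within (fun s => 0 <= s) (locally t)) (fun h => scal h (f' t)).

(** [P] is a twice continuously differentiable motion, for [0 <= t], of a knot of mass
    [m0] released from rest at [A1]. The knot is not at [A2] or [A3] at any time, since
    the right-hand side of the equation of motion is undefined there. Values of [P] at
    negative times are irrelevant. *)
Definition oscillatory_FT_tree
    (A1 A2 A3 : point) (w1 w2 w3 m0 : R) (O : point) (P : R -> point) : Prop :=
  exists V W : R -> point,
    is_derivative_nonneg P V /\
    is_derivative_nonneg V W /\
    continuous_on (fun t => 0 <= t) W /\
    P 0 = A1 /\
    V 0 = zero /\
    (forall t : R, 0 <= t ->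
       P t <> A2 /\ P t <> A3 /\
       scal m0 (W t) =
         plus (scal w1 (first_string_direction A1 O (P t)))
              (plus (scal w2 (unit_vector (P t) A2))
                    (scal w3 (unit_vector (P t) A3)))).

Definition on_line (A B S : point) : Prop :=
  exists k : R, S = plus A (scal k (minus B A)).

(* Main.v *)
Require Import Defs.
From Stdlib Require Import Reals Lra Lia Psatz Classical.
From Coquelicot Require Import Coquelicot.
Open Scope R_scope.

(** Take [A1] as origin, the height towards [A4] as first axis and the
    direction from [A4] to [A3] as second axis. The holes become [(0, 0)],
    [(h, - b)] and [(h, b)]; write [w] for the common weight of the last two and
    [m] for the mass. At [(x, 0)] with [0 <= x] the force is axial and equal to
    [axial_force h b w x], the opposite of the derivative of
    [potential h b w x]. The assumption on the angle says exactly that this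
    force is positive at [A1] ([pull_of_angle]). It is positive up to a single
    point of the axis, [equilibrium h b w], where the three weighted unit
    vectors cancel; by Cauchy-Schwarz this point minimizes the weighted sum of
    distances, so it is [O] ([equilibrium_is_FT_point]).

    A motion exists because the axial force is globally Lipschitz, so that
    Picard iteration gives a solution for all times ([second_order_existence]).
    The potential is convex and decreasing at [A1], so conservation of energy
    keeps the solution at [0 <= x], where the axial force is the true force of
    the system ([tree_of_axial_motion]).

    That every motion stays on the axis is the delicate point, since the force
    of the first string is discontinuous at [A1], where the motion starts and to
    which it may return: uniqueness theorems for Lipschitz equations do not
    apply. The transverse coordinate satisfies [m y'' = - y / r + N], where [r]
    is the distance to [A1] and [N] is bounded by a multiple of [y]. The
    singular term is attractive, and the energy [m y'^2 + y^2 / r] satisfies a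
    Gronwall inequality as long as [r] does not decrease too fast; its initial
    value is [0] because [y^2 / r] is at most [Rabs y] ([singular_gronwall]).
    Near a time when the knot is at rest at [A1], the acceleration is axial and
    nonzero, which forces [r] to increase ([axis_extension_singular]); at other
    times [r] stays away from [0] ([axis_extension_regular]). The energy of the
    axial motion shows that the knot is always at rest when it is at [A1]. Real
    induction then covers all times ([stays_on_axis]).

    Finally the knot accelerates as long as it has not reached [O], hence gets
    there with positive speed ([reaches_level]), and the conservation of energy
    between [A1] and [O] gives the value of that speed. The subtracted term of
    the formula is twice [w] times the distance from [O] to [A3], because
    [sin phi0 = b / a] and the other sine is [b] divided by that distance. *)

(** * Calculus on a half-line *)

Lemma continuous_of_derive (f : R -> R) (t l : R) : is_derive f t l -> continuous f t.
Proof.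
  intro hf. apply (ex_derive_continuous (V := R_NormedModule)). now exists l.
Qed.

(** The derivative is needed only inside the interval: a motion that is
    extended by constants to negative times need not be differentiable at time
    [0]. *)
Lemma mean_value_open (f f' : R -> R) (a b : R) :
  a < b ->
  (forall t, a <= t <= b -> continuous f t) ->
  (forall t, a < t < b -> is_derive f t (f' t)) ->
  exists c, a < c < b /\ f b - f a = f' c * (b - a).
Proof.
  intros hab hc hd.
  (* Redefining the derivative at the endpoints to be its value at the middle
     turns a closed-interval witness into an interior one. *)
  set (g := fun t => match Rlt_dec a t with
                     | left _ => match Rlt_dec t b with
                                 | left _ => f' t
                                 | right _ => f' ((a + b) / 2)
                                 end
                     | right _ => f' ((a + b) / 2)
                     end).
  destruct (MVT_gen f a b g) as [c [_ Hc]].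
  - rewrite Rmin_left, Rmax_right by lra. intros t Ht. unfold g.
    destruct (Rlt_dec a t); [|lra]. destruct (Rlt_dec t b); [|lra].
    now apply hd.
  - intros t Ht. rewrite Rmin_left, Rmax_right in Ht by lra.
    apply continuity_pt_filterlim. now apply hc.
  - unfold g in Hc. destruct (Rlt_dec a c).
    + destruct (Rlt_dec c b).
      * exists c. split; [lra | exact Hc].
      * exists ((a + b) / 2). split; [lra | exact Hc].
    + exists ((a + b) / 2). split; [lra | exact Hc].
Qed.

Lemma increasing_of_derive (f f' : R -> R) (a b : R) :
  a < b ->
  (forall t, a <= t <= b -> continuous f t) ->
  (forall t, a < t < b -> is_derive f t (f' t)) ->
  (forall t, a < t < b -> 0 < f' t) ->
  f a < f b.
Proof.
  intros hab hc hd hp.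
  destruct (mean_value_open f f' a b hab hc hd) as [c [hac E]].
  specialize (hp c hac). nra.
Qed.

Lemma nondecreasing_of_derive (f f' : R -> R) (a b : R) :
  a < b ->
  (forall t, a <= t <= b -> continuous f t) ->
  (forall t, a < t < b -> is_derive f t (f' t)) ->
  (forall t, a < t < b -> 0 <= f' t) ->
  f a <= f b.
Proof.
  intros hab hc hd hp.
  destruct (mean_value_open f f' a b hab hc hd) as [c [hac E]].
  specialize (hp c hac). nra.
Qed.

Lemma constant_of_derive (f f' : R -> R) (a b : R) :
  a < b ->
  (forall t, a <= t <= b -> continuous f t) ->
  (forall t, a < t < b -> is_derive f t (f' t)) ->
  (forall t, a < t < b -> f' t = 0) ->
  f b = f a.
Proof.
  intros hab hc hd hp.
  destruct (mean_value_open f f' a b hab hc hd) as [c [hac E]].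
  rewrite (hp c hac) in E. lra.
Qed.

Lemma Derive_value (f : R -> R) (t l : R) :
  is_derive f t l -> Derive (fun s : R => f s) t = l.
Proof. apply is_derive_unique. Qed.

(** Used for properties that hold on a closed set of times and can always be
    continued a little further to the right. The supremum of the times up to
    which [Q] holds would otherwise be a last such time. *)
Lemma real_induction (Q : R -> Prop) :
  (forall T, 0 <= T -> (forall s, 0 <= s < T -> Q s) -> Q T) ->
  (forall T, 0 <= T -> (forall s, 0 <= s <= T -> Q s) ->
     exists d, 0 < d /\ forall s, T < s < T + d -> Q s) ->
  forall t, 0 <= t -> Q t.
Proof.
  intros hclosed hopen t ht.
  destruct (classic (Q t)) as [hQ | hQ]; [exact hQ | exfalso].
  set (E := fun T => 0 <= T <= t /\ forall s, 0 <= s < T -> Q s).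
  assert (bE : bound E).
  { exists t. intros T [HT _]. lra. }
  assert (nE : exists T, E T).
  { exists 0. split; [lra|]. intros s hs. lra. }
  destruct (completeness E bE nE) as [S [hub hlub]].
  assert (hS0 : 0 <= S).
  { apply hub. split; [lra|]. intros s hs. lra. }
  assert (hSt : S <= t).
  { apply hlub. intros T [HT _]. lra. }
  assert (hSQ : forall s, 0 <= s < S -> Q s).
  { intros s hs. apply NNPP. intro hn.
    assert (S <= s); [|lra].
    apply hlub. intros T [HT hT].
    destruct (Rle_dec T s) as [|hlt]; [assumption|].
    exfalso. apply hn, hT. lra. }
  assert (hQS : Q S) by (apply hclosed; assumption).
  destruct (hopen S hS0) as [d [hd hext]].
  { intros s hs. destruct (Req_dec s S) as [->|]; [assumption|]. apply hSQ. lra. }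
  assert (hSlt : S < t).
  { destruct (Req_dec S t) as [E1|]; [|lra]. subst. contradiction. }
  assert (E (Rmin t (S + d))).
  { split.
    - split; [apply Rmin_glb; lra | apply Rmin_l].
    - intros s hs. pose proof (Rmin_r t (S + d)).
      destruct (Rlt_dec s S); [apply hSQ; lra|].
      destruct (Req_dec s S) as [->|]; [assumption|]. apply hext. lra. }
  apply hub in H. unfold Rmin in H. destruct (Rle_dec t (S + d)); lra.
Qed.

Lemma continuous_near (f : R -> R) (T eps : R) :
  continuous f T -> 0 < eps ->
  exists d, 0 < d /\ forall s, Rabs (s - T) < d -> Rabs (f s - f T) < eps.
Proof.
  intros hc he.
  assert (H := proj1 (filterlim_locally (F := locally T) f (f T)) hc (mkposreal eps he)).
  destruct H as [d hd]. exists d. split; [apply cond_pos|].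
  intros s hs. apply hd. exact hs.
Qed.

Lemma positive_near (f : R -> R) (T : R) :
  continuous f T -> 0 < f T -> locally T (fun s => 0 < f s).
Proof.
  intros hc hp. apply (hc (fun u => 0 < u)). now apply open_gt.
Qed.

Lemma locally_interval (Q : R -> Prop) (T : R) :
  locally T Q -> exists d, 0 < d /\ forall s, T - d < s < T + d -> Q s.
Proof.
  intros [d hd]. exists d. split; [apply cond_pos|].
  intros s hs. apply hd. change (Rabs (s - T) < d). apply Rabs_def1; lra.
Qed.

Lemma nonneg_left_limit (f : R -> R) (T : R) :
  continuous f T -> 0 < T -> (forall s, 0 <= s < T -> 0 <= f s) -> 0 <= f T.
Proof.
  intros hc hT hf. destruct (Rle_dec 0 (f T)) as [|hn]; [assumption|exfalso].
  destruct (continuous_near f T (- f T) hc ltac:(lra)) as [d [hd H]].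
  set (s := Rmax 0 (T - d / 2)).
  assert (0 <= s < T) by (unfold s, Rmax; destruct (Rle_dec 0 (T - d / 2)); lra).
  assert (T - d < s) by (unfold s, Rmax; destruct (Rle_dec 0 (T - d / 2)); lra).
  specialize (hf s H0).
  assert (Hs := H s ltac:(apply Rabs_def1; lra)). apply Rabs_def2 in Hs. lra.
Qed.

(** If there were no such time, [f < c] would propagate from [0] to all times
    by real induction: at the first failure, continuity forces [f] to be equal
    to [c]. *)
Lemma first_hitting_time (f : R -> R) (c t1 : R) :
  (forall t, continuous f t) -> f 0 < c -> 0 <= t1 -> c <= f t1 ->
  exists t0, 0 < t0 /\ f t0 = c /\ forall t, 0 <= t < t0 -> f t < c.
Proof.
  intros hc h0 ht1 h1. apply NNPP. intro hno.
  assert (H : forall t, 0 <= t -> f t < c).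
  { apply real_induction.
    - intros T hT hbelow. destruct (Rlt_dec (f T) c) as [|hge]; [assumption|exfalso].
      assert (hTpos : 0 < T).
      { destruct (Req_dec T 0) as [->|]; lra. }
      apply hno. exists T. split; [assumption|]. split; [|assumption].
      assert (0 <= c - f T); [|lra].
      apply (nonneg_left_limit (fun t => c - f t)); [|assumption|].
      + apply (continuous_minus (fun _ => c) f); [apply continuous_const | apply hc].
      + intros s hs. specialize (hbelow s hs). lra.
    - intros T hT hbelow.
      destruct (locally_interval (fun t => 0 < c - f t) T) as [d [hd H]].
      + apply (positive_near (fun t => c - f t)).
        * apply (continuous_minus (fun _ => c) f); [apply continuous_const | apply hc].
        * specialize (hbelow T ltac:(lra)). lra.
      + exists d. split; [assumption|]. intros s hs. specialize (H s ltac:(lra)). simpl in H. lra. }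
  specialize (H t1 ht1). lra.
Qed.

(** * Global solutions of Lipschitz second order equations *)

(** Serves to bound a function by a multiple of another one on both sides of
    [0] at once, from a bound on second derivatives. *)
Lemma minimum_of_convex (g g' g'' : R -> R) :
  (forall t, is_derive g t (g' t)) ->
  (forall t, is_derive g' t (g'' t)) ->
  g' 0 = 0 -> (forall t, 0 <= g'' t) ->
  forall t, g 0 <= g t.
Proof.
  intros h1 h2 h0 hpos t.
  assert (c1 : forall s, continuous g s).
  { intro s. eapply continuous_of_derive. apply h1. }
  assert (c2 : forall s, continuous g' s).
  { intro s. eapply continuous_of_derive. apply h2. }
  destruct (Rtotal_order t 0) as [ht | [-> | ht]]; [| lra |].
  - destruct (mean_value_open g g' t 0 ht (fun s _ => c1 s) (fun s _ => h1 s)) as [c [hc E]].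
    destruct (mean_value_open g' g'' c 0 ltac:(lra) (fun s _ => c2 s) (fun s _ => h2 s)) as [d [hd E']].
    specialize (hpos d). assert (g' c <= 0) by nra. nra.
  - destruct (mean_value_open g g' 0 t ht (fun s _ => c1 s) (fun s _ => h1 s)) as [c [hc E]].
    destruct (mean_value_open g' g'' 0 c ltac:(lra) (fun s _ => c2 s) (fun s _ => h2 s)) as [d [hd E']].
    specialize (hpos d). assert (0 <= g' c) by nra. nra.
Qed.

(** Twice the hyperbolic cosine of [k * t]. Its second derivative is [k ^ 2]
    times itself, and it has a critical point at [0]: with [k] large,
    integrating twice from [0] divides a bound of this shape by [k ^ 2],
    uniformly over the whole line. *)
Definition growth (k t : R) : R := exp (k * t) + exp (- (k * t)).

Lemma growth_ge_1 (k t : R) : 1 <= growth k t.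
Proof.
  unfold growth. rewrite exp_Ropp. pose proof (exp_pos (k * t)) as hp.
  set (u := exp (k * t)) in *.
  assert (0 < / u) by now apply Rinv_0_lt_compat.
  assert (u * / u = 1) by (apply Rinv_r; lra). nra.
Qed.

Lemma exp_mono (x y : R) : x <= y -> exp x <= exp y.
Proof.
  intros [h | ->]; [left; now apply exp_increasing | lra].
Qed.

(** Both [C * growth k + g] and [C * growth k - g] are convex with a critical
    point and a nonnegative value at [0], hence nonnegative. *)
Lemma growth_comparison (k C : R) (g g' g'' : R -> R) :
  0 < k -> 0 <= C ->
  (forall t, is_derive g t (g' t)) ->
  (forall t, is_derive g' t (g'' t)) ->
  g 0 = 0 -> g' 0 = 0 ->
  (forall t, Rabs (g'' t) <= C * k ^ 2 * growth k t) ->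
  forall t, Rabs (g t) <= C * growth k t.
Proof.
  intros hk hC h1 h2 h0 h0' hb t.
  assert (G1 : forall s, is_derive (fun s => C * growth k s) s
                 (C * (k * (exp (k * s) - exp (- (k * s)))))).
  { intro s. unfold growth. auto_derive; [easy|]. ring. }
  assert (G2 : forall s, is_derive (fun s => C * (k * (exp (k * s) - exp (- (k * s))))) s
                 (C * k ^ 2 * growth k s)).
  { intro s. unfold growth. auto_derive; [easy|]. ring. }
  assert (D : forall s, Rabs (g'' s) <= C * k ^ 2 * growth k s ->
            g'' s <= C * k ^ 2 * growth k s /\ - g'' s <= C * k ^ 2 * growth k s).
  { intros s Hs. apply Rabs_le_between in Hs. lra. }
  assert (E0 : 0 <= C * growth k 0).
  { pose proof (growth_ge_1 k 0). nra. }
  assert (Z : C * (k * (exp (k * 0) - exp (- (k * 0)))) = 0).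
  { rewrite Rmult_0_r, Ropp_0. ring. }
  apply Rabs_le. split.
  - assert (H := minimum_of_convex
       (fun s => plus (C * growth k s) (g s))
       (fun s => plus (C * (k * (exp (k * s) - exp (- (k * s))))) (g' s))
       (fun s => plus (C * k ^ 2 * growth k s) (g'' s))
       (fun s => is_derive_plus _ _ _ _ _ (G1 s) (h1 s))
       (fun s => is_derive_plus _ _ _ _ _ (G2 s) (h2 s))).
    unfold plus in H; simpl in H.
    specialize (H ltac:(rewrite h0'; lra)
      ltac:(intro s; pose proof (D s (hb s)); lra) t).
    rewrite h0 in H. lra.
  - assert (H := minimum_of_convex
       (fun s => minus (C * growth k s) (g s))
       (fun s => minus (C * (k * (exp (k * s) - exp (- (k * s))))) (g' s))
       (fun s => minus (C * k ^ 2 * growth k s) (g'' s))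
       (fun s => is_derive_minus _ _ _ _ _ (G1 s) (h1 s))
       (fun s => is_derive_minus _ _ _ _ _ (G2 s) (h2 s))).
    unfold minus, plus, opp in H; simpl in H.
    specialize (H ltac:(rewrite h0'; lra)
      ltac:(intro s; pose proof (D s (hb s)); lra) t).
    rewrite h0 in H. lra.
Qed.

Lemma double_primitive (u : R -> R) :
  (forall t, continuous u t) ->
  let v := fun t => RInt u 0 t in
  let x := fun t => RInt v 0 t in
  (forall t, is_derive x t (v t)) /\ (forall t, is_derive v t (u t)) /\
  x 0 = 0 /\ v 0 = 0.
Proof.
  intros hu v x.
  assert (P : forall w : R -> R, (forall t, continuous w t) ->
            forall t, is_derive (fun s => RInt w 0 s) t (w t)).
  { intros w hw t. apply (is_derive_RInt w _ 0).
    - apply filter_forall. intro s. apply (RInt_correct w).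
      apply ex_RInt_continuous. intros z _. apply hw.
    - apply hw. }
  assert (hv : forall t, is_derive v t (u t)) by (apply P; assumption).
  split; [|split; [assumption | split; exact (RInt_point 0 _)]].
  apply P. intro t. eapply continuous_of_derive. apply hv.
Qed.

Definition picard_step (f x : R -> R) : R -> R :=
  fun t => RInt (fun s => RInt (fun r => f (x r)) 0 s) 0 t.

Fixpoint picard (f : R -> R) (n : nat) : R -> R :=
  match n with
  | O => fun _ => 0
  | S n => picard_step f (picard f n)
  end.

Definition lipschitz (L : R) (f : R -> R) : Prop :=
  forall x y, Rabs (f x - f y) <= L * Rabs (x - y).

Lemma lipschitz_continuous (L : R) (f : R -> R) :
  0 < L -> lipschitz L f -> forall x, continuous f x.
Proof.
  intros hL hf x. apply filterlim_locally. intro eps.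
  assert (hd : 0 < eps / L) by (apply Rdiv_lt_0_compat; [apply cond_pos | lra]).
  exists (mkposreal _ hd). intros y hy.
  change (Rabs (f y - f x) < eps).
  change (Rabs (y - x) < eps / L) in hy.
  apply Rle_lt_trans with (1 := hf y x).
  apply (Rmult_lt_compat_l L) in hy; [|assumption].
  replace (L * (eps / L)) with (pos eps) in hy by (field; lra). exact hy.
Qed.

Lemma picard_continuous (L : R) (f : R -> R) (n : nat) :
  0 < L -> lipschitz L f -> forall t, continuous (picard f n) t.
Proof.
  intros hL hf. induction n as [|n IH]; intro t.
  - apply continuous_const.
  - eapply continuous_of_derive.
    refine (proj1 (double_primitive (fun r => f (picard f n r)) _) t).
    intro s. apply (continuous_comp (picard f n) f); [apply IH|].
    now apply lipschitz_continuous with L.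
Qed.

(** The integral operator is a contraction for the norm weighted by [growth
    k], as soon as [k ^ 2] is at least twice the Lipschitz constant. *)
Lemma picard_step_comparison (L k C : R) (f x y : R -> R) :
  0 < L -> lipschitz L f -> 0 < k -> 0 <= C -> 2 * L <= k ^ 2 ->
  (forall t, continuous x t) -> (forall t, continuous y t) ->
  (forall t, Rabs (x t - y t) <= C * growth k t) ->
  forall t, Rabs (picard_step f x t - picard_step f y t) <= C / 2 * growth k t.
Proof.
  intros hL hf hk hC hkL cx cy hxy.
  assert (cf := lipschitz_continuous L f hL hf).
  assert (D : forall z : R -> R, (forall t, continuous z t) ->
              forall t, continuous (fun r => f (z r)) t).
  { intros z hz t. apply (continuous_comp z f); [apply hz | apply cf]. }
  destruct (double_primitive (fun r => f (x r)) (D x cx)) as (x1 & x2 & x3 & x4).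
  destruct (double_primitive (fun r => f (y r)) (D y cy)) as (y1 & y2 & y3 & y4).
  apply (growth_comparison k (C / 2)
    (fun t => minus (picard_step f x t) (picard_step f y t))
    (fun t => minus (RInt (fun r => f (x r)) 0 t) (RInt (fun r => f (y r)) 0 t))
    (fun t => minus (f (x t)) (f (y t)))).
  - assumption.
  - lra.
  - intro t. apply (is_derive_minus (V := R_NormedModule)); [apply x1 | apply y1].
  - intro t. apply (is_derive_minus (V := R_NormedModule)); [apply x2 | apply y2].
  - unfold picard_step. rewrite x3, y3. apply Rminus_diag.
  - rewrite x4, y4. apply Rminus_diag.
  - intro t. apply Rle_trans with (1 := hf (x t) (y t)).
    specialize (hxy t). pose proof (growth_ge_1 k t).
    apply Rle_trans with (L * (C * growth k t)).
    + apply Rmult_le_compat_l; lra.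
    + replace (L * (C * growth k t)) with (2 * L * (C / 2 * growth k t)) by field.
      replace (C / 2 * k ^ 2 * growth k t) with (k ^ 2 * (C / 2 * growth k t)) by ring.
      apply Rmult_le_compat_r; [|assumption].
      assert (0 <= C / 2) by lra. nra.
Qed.

Lemma half_pow_pos (n : nat) : 0 < (1 / 2) ^ n.
Proof. apply pow_lt. lra. Qed.

Lemma half_pow_small (C : R) : is_lim_seq (fun n => C * (1 / 2) ^ n) 0.
Proof.
  assert (H := is_lim_seq_scal_l _ C 0
    (is_lim_seq_geom (1 / 2) ltac:(rewrite Rabs_pos_eq; lra))).
  simpl in H. rewrite Rmult_0_r in H. exact H.
Qed.

Lemma small_of_half_pow (a C : R) :
  (forall n, a <= C * (1 / 2) ^ n) -> a <= 0.
Proof.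
  intro H. apply (is_lim_seq_le (fun _ => a) _ a 0 H).
  - apply is_lim_seq_const.
  - apply half_pow_small.
Qed.

(** The iterates converge geometrically for the norm weighted by [growth k],
    with no restriction on time. The limit is continuous because the
    convergence is locally uniform, and it is a fixed point of the integral
    operator by contraction. *)
Theorem second_order_existence (L : R) (f : R -> R) :
  0 < L -> lipschitz L f ->
  exists x v : R -> R,
    x 0 = 0 /\ v 0 = 0 /\
    (forall t, is_derive x t (v t)) /\ (forall t, is_derive v t (f (x t))).
Proof.
  intros hL hf.
  set (k := 2 * L + 1).
  assert (hk : 0 < k) by (unfold k; lra).
  assert (hkL : 2 * L <= k ^ 2) by (unfold k; nra).
  (* The first iterate has constant second derivative [f 0]. *)
  set (C := Rabs (f 0) / k ^ 2).
  assert (hk2 : 0 < k ^ 2) by (apply pow_lt; assumption).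
  assert (hC : 0 <= C).
  { apply Rdiv_le_0_compat; [apply Rabs_pos | assumption]. }
  assert (cp := fun n => picard_continuous L f n hL hf).
  assert (step : forall n t, Rabs (picard f (S n) t - picard f n t)
                             <= C * (1 / 2) ^ n * growth k t).
  { induction n as [|n IH]; intro t.
    - destruct (double_primitive (fun _ => f 0)) as (h1 & h2 & h3 & h4).
      { intro s. apply continuous_const. }
      simpl. rewrite Rminus_0_r, Rmult_1_r.
      apply (growth_comparison k C _ _ (fun _ => f 0) hk hC h1 h2 h3 h4).
      intro s. replace (C * k ^ 2) with (Rabs (f 0)).
      + pose proof (growth_ge_1 k s). pose proof (Rabs_pos (f 0)). nra.
      + unfold C. field. lra.
    - replace (C * (1 / 2) ^ S n) with (C * (1 / 2) ^ n / 2) by (simpl; field).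
      apply (picard_step_comparison L k _ f (picard f (S n)) (picard f n) hL hf hk);
        try assumption; try (intro s; apply cp).
      pose proof (half_pow_pos n). nra. }
  assert (tail : forall n p t, Rabs (picard f (n + p) t - picard f n t)
                 <= 2 * C * (1 / 2) ^ n * growth k t - 2 * C * (1 / 2) ^ (n + p) * growth k t).
  { intros n p t. induction p as [|p IH].
    - rewrite Nat.add_0_r, Rminus_diag, Rabs_R0. lra.
    - rewrite Nat.add_succ_r.
      replace (picard f (S (n + p)) t - picard f n t) with
        ((picard f (S (n + p)) t - picard f (n + p) t)
         + (picard f (n + p) t - picard f n t)) by ring.
      apply Rle_trans with (1 := Rabs_triang _ _).
      specialize (step (n + p)%nat t). simpl pow. lra. }
  assert (gpos : forall t, 0 < growth k t).
  { intro t. pose proof (growth_ge_1 k t). lra. }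
  assert (tail' : forall n m t, (n <= m)%nat ->
            Rabs (picard f m t - picard f n t) <= 2 * C * growth k t * (1 / 2) ^ n).
  { intros n m t hnm. replace m with (n + (m - n))%nat by lia.
    specialize (tail n (m - n)%nat t).
    assert (0 <= 2 * C * (1 / 2) ^ (n + (m - n)) * growth k t); [|lra].
    pose proof (half_pow_pos (n + (m - n))). specialize (gpos t).
    apply Rmult_le_pos; [nra | lra]. }
  assert (conv : forall t, ex_finite_lim_seq (fun n => picard f n t)).
  { intro t. apply ex_lim_seq_cauchy_corr. intro eps.
    destruct (proj2 (is_lim_seq_spec _ _) (half_pow_small (2 * C * growth k t))
                (mkposreal (eps / 2) ltac:(pose proof (cond_pos eps); lra))) as [N HN].
    exists N. intros n m hn hm.
    specialize (HN N (le_n N)). simpl in HN. rewrite Rminus_0_r in HN.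
    apply Rabs_def2 in HN.
    pose proof (tail' N n t hn). pose proof (tail' N m t hm).
    replace (picard f n t - picard f m t) with
      ((picard f n t - picard f N t) - (picard f m t - picard f N t)) by ring.
    apply Rle_lt_trans with (1 := Rabs_triang _ _). rewrite Rabs_Ropp. lra. }
  set (x := fun t => real (Lim_seq (fun n => picard f n t))).
  assert (lim : forall t, is_lim_seq (fun n => picard f n t) (x t)).
  { intro t. apply Lim_seq_correct'. apply conv. }
  assert (close : forall n t, Rabs (x t - picard f n t) <= 2 * C * (1 / 2) ^ n * growth k t).
  { intros n t.
    refine (is_lim_seq_le (fun p => Rabs (picard f (p + n) t - picard f n t))
      (fun _ => 2 * C * (1 / 2) ^ n * growth k t) (Rabs (x t - picard f n t))
      (2 * C * (1 / 2) ^ n * growth k t) _ _ _).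
    - intro p. specialize (tail' n (p + n)%nat t ltac:(lia)). simpl in tail'. lra.
    - apply (is_lim_seq_abs _ (x t - picard f n t)).
      apply is_lim_seq_minus'; [|apply is_lim_seq_const].
      apply (is_lim_seq_incr_n (fun p => picard f p t)). apply lim.
    - apply is_lim_seq_const. }
  assert (cx : forall t, continuous x t).
  { intro t. apply continuity_pt_filterlim.
    set (M := growth k (Rabs t + 1)).
    assert (hM : forall y, Boule t (mkposreal 1 Rlt_0_1) y -> growth k y <= 2 * M).
    { intros y hy. unfold Boule in hy. simpl in hy. apply Rabs_def2 in hy.
      pose proof (Rle_abs t). pose proof (Rabs_maj2 t). unfold growth, M, growth.
      pose proof (exp_pos (- (k * (Rabs t + 1)))).
      assert (exp (k * y) <= exp (k * (Rabs t + 1))) by (apply exp_mono; nra).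
      assert (exp (- (k * y)) <= exp (k * (Rabs t + 1))) by (apply exp_mono; nra). lra. }
    apply (CVU_continuity (fun n => picard f n) x t (mkposreal 1 Rlt_0_1)).
    - intros eps heps.
      destruct (proj2 (is_lim_seq_spec _ _) (half_pow_small (2 * C * (2 * M)))
                (mkposreal eps heps)) as [N HN].
      exists N. intros n y hn hy. specialize (HN n hn). simpl in HN.
      rewrite Rminus_0_r in HN. apply Rabs_def2 in HN.
      specialize (close n y). specialize (hM y hy).
      apply Rle_lt_trans with (1 := close).
      apply Rle_lt_trans with (2 := proj1 HN).
      replace (2 * C * (2 * M) * (1 / 2) ^ n) with (2 * C * (1 / 2) ^ n * (2 * M)) by ring.
      apply Rmult_le_compat_l; [|assumption].
      pose proof (half_pow_pos n). nra.
    - intros n y _. apply continuity_pt_filterlim. apply cp.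
    - unfold Boule. rewrite Rminus_diag, Rabs_R0. apply Rlt_0_1. }
  (* The integral operator maps [x] to a function as close to the iterates as
     [x] itself is, so that [x] is a fixed point. *)
  assert (fix_x : forall t, x t = picard_step f x t).
  { intro t.
    assert (Rabs (x t - picard_step f x t) <= 0).
    { apply (small_of_half_pow _ (2 * C * growth k t)). intro n.
      replace (x t - picard_step f x t) with
        ((x t - picard f (S n) t) + (picard f (S n) t - picard_step f x t)) by ring.
      apply Rle_trans with (1 := Rabs_triang _ _).
      assert (H1 := close (S n) t).
      assert (hn := half_pow_pos n).
      assert (H2 := picard_step_comparison L k (2 * C * (1 / 2) ^ n) f x (picard f n)
        hL hf hk ltac:(nra) hkL cx (cp n) (close n) t).
      rewrite <- Rabs_Ropp in H2.
      replace (- (picard_step f x t - picard_step f (picard f n) t))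
        with (picard f (S n) t - picard_step f x t) in H2 by (simpl; ring).
      simpl pow in H1. lra. }
    pose proof (Rabs_pos (x t - picard_step f x t)).
    assert (Rabs (x t - picard_step f x t) = 0) by lra.
    destruct (Req_dec (x t - picard_step f x t) 0); [lra|].
    exfalso. now apply (Rabs_no_R0 (x t - picard_step f x t)). }
  destruct (double_primitive (fun r => f (x r))) as (h1 & h2 & h3 & h4).
  { intro t. apply (continuous_comp x f); [apply cx|].
    now apply lipschitz_continuous with L. }
  exists x, (fun t => RInt (fun r => f (x r)) 0 t).
  split; [rewrite fix_x; exact h3|]. split; [exact h4|]. split; [|exact h2].
  intro t. apply is_derive_ext with (picard_step f x); [|apply h1].
  intro s. symmetry. apply fix_x.
Qed.

(** * Transverse motion near a singular attracting force *)

(** The equation for [y] is singular where [r = sqrt (x^2 + y^2)] vanishes,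
    which may happen at time [T]. Let [E = m vy^2 + y^2 / r]. The
    contributions of the singular force and of the numerator of [y^2 / r]
    cancel in the derivative of [E], which leaves [2 vy N - y^2 r' / r^2]. The
    first term is at most a multiple of [E]; the hypothesis [r' >= - K r],
    written without division, makes the second one at most [K E]. So [E exp (-
    lam t)] is nonincreasing after [T], and its limit at [T] is [0]. *)
Lemma singular_gronwall (m G R0 K T T' : R) (x y vx vy wy N : R -> R) :
  0 < m -> 0 <= G -> 0 <= R0 -> 0 <= K ->
  (forall t, continuous y t) -> (forall t, continuous vy t) ->
  y T = 0 -> vy T = 0 ->
  (forall t, T < t < T' -> is_derive x t (vx t)) ->
  (forall t, T < t < T' -> is_derive y t (vy t)) ->
  (forall t, T < t < T' -> is_derive vy t (wy t)) ->
  (forall t, T < t < T' -> 0 < x t ^ 2 + y t ^ 2 <= R0 ^ 2) ->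
  (forall t, T < t < T' -> 0 <= x t * vx t + y t * vy t + K * (x t ^ 2 + y t ^ 2)) ->
  (forall t, T < t < T' -> m * wy t = - y t / sqrt (x t ^ 2 + y t ^ 2) + N t) ->
  (forall t, T < t < T' -> Rabs (N t) <= G * Rabs (y t)) ->
  forall t, T < t < T' -> y t = 0 /\ vy t = 0.
Proof.
  intros hm hG hR hK cy cvy y0 vy0 dx dy dvy hr hrad heq hN t ht.
  set (r := fun s => sqrt (x s ^ 2 + y s ^ 2)).
  set (E := fun s => m * vy s ^ 2 + y s ^ 2 / r s).
  set (lam := G / m + G * R0 + K).
  assert (rpos : forall s, T < s < T' -> 0 < r s).
  { intros s hs. apply sqrt_lt_R0. apply hr, hs. }
  assert (rsq : forall s, T < s < T' -> r s * r s = x s ^ 2 + y s ^ 2).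
  { intros s hs. apply sqrt_sqrt. left. apply hr, hs. }
  assert (rle : forall s, T < s < T' -> r s <= R0).
  { intros s hs. unfold r. rewrite <- (sqrt_pow2 R0 hR). apply sqrt_le_1_alt. apply hr, hs. }
  set (dE := fun s => 2 * vy s * N s
                      - y s ^ 2 * (x s * vx s + y s * vy s) / r s ^ 3).
  assert (derE : forall s, T < s < T' -> is_derive E s (dE s)).
  { intros s hs. unfold E, r.
    specialize (rpos s hs). specialize (rsq s hs).
    specialize (hr s hs). specialize (heq s hs). fold (r s) in heq.
    auto_derive.
    - assert (0 < x s * (x s * 1) + y s * (y s * 1)) by (simpl in hr; lra).
      repeat split; try (eexists; now eauto); try assumption.
      apply Rgt_not_eq, sqrt_lt_R0. assumption.
    - rewrite (Derive_value vy _ _ (dvy s hs)).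
      rewrite (Derive_value x _ _ (dx s hs)).
      rewrite (Derive_value y _ _ (dy s hs)).
      replace (x s * (x s * 1) + y s * (y s * 1)) with (x s ^ 2 + y s ^ 2) by ring.
      fold (r s). unfold dE.
      replace (N s) with (m * wy s + y s / r s) by (rewrite heq; field; lra).
      field. lra. }
  assert (dE_le : forall s, T < s < T' -> dE s <= lam * E s).
  { intros s hs. unfold dE, lam, E.
    specialize (rpos s hs). specialize (rsq s hs). specialize (rle s hs).
    specialize (hN s hs). specialize (hrad s hs).
    set (q := y s ^ 2 / r s).
    assert (q0 : 0 <= q) by (apply Rdiv_le_0_compat; [apply pow2_ge_0 | assumption]).
    assert (hq : q * r s = y s ^ 2) by (unfold q; field; lra).
    assert (A1 : 2 * vy s * N s <= G * (vy s ^ 2 + y s ^ 2)).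
    { apply Rle_trans with (2 * (Rabs (vy s) * (G * Rabs (y s)))).
      - rewrite Rmult_assoc. apply Rmult_le_compat_l; [lra|].
        apply Rle_trans with (1 := Rle_abs _). rewrite Rabs_mult.
        apply Rmult_le_compat_l; [apply Rabs_pos | assumption].
      - rewrite <- (pow2_abs (vy s)), <- (pow2_abs (y s)).
        pose proof (pow2_ge_0 (Rabs (vy s) - Rabs (y s))). nra. }
    assert (A2 : - (y s ^ 2 * (x s * vx s + y s * vy s) / r s ^ 3) <= K * q).
    { replace (- (y s ^ 2 * (x s * vx s + y s * vy s) / r s ^ 3))
        with (q * (- (x s * vx s + y s * vy s) / (r s * r s))) by (unfold q; field; lra).
      rewrite (Rmult_comm K). apply Rmult_le_compat_l; [assumption|].
      apply Rle_div_l; [nra|]. rewrite rsq. lra. }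
    assert (A3 : G * y s ^ 2 <= G * R0 * q).
    { rewrite <- hq. rewrite Rmult_assoc. apply Rmult_le_compat_l; [assumption|]. nra. }
    assert (A4 : (G / m + G * R0 + K) * (m * vy s ^ 2 + q)
       = G * vy s ^ 2 + (G * R0 + K) * (m * vy s ^ 2) + (G / m * q + G * R0 * q + K * q))
      by (field; lra).
    rewrite A4.
    assert (0 <= (G * R0 + K) * (m * vy s ^ 2)).
    { apply Rmult_le_pos; [nra|]. pose proof (pow2_ge_0 (vy s)). nra. }
    assert (0 <= G / m * q).
    { apply Rmult_le_pos; [|assumption]. apply Rdiv_le_0_compat; assumption. }
    lra. }
  assert (mono : forall s u, T < s -> s < u -> u < T' ->
                 E u * exp (- (lam * u)) <= E s * exp (- (lam * s))).
  { intros s u hs hsu hu.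
    assert (D : forall z, T < z < T' -> is_derive (fun z => - (E z * exp (- (lam * z)))) z
                  (- ((dE z - lam * E z) * exp (- (lam * z))))).
    { intros z hz. auto_derive; [eexists; eauto|].
      rewrite (Derive_value E _ _ (derE z hz)). ring. }
    assert (H := nondecreasing_of_derive (fun z => - (E z * exp (- (lam * z))))
      (fun z => - ((dE z - lam * E z) * exp (- (lam * z)))) s u hsu).
    assert (- (E s * exp (- (lam * s))) <= - (E u * exp (- (lam * u)))); [|lra].
    apply H.
    - intros z hz. eapply continuous_of_derive. apply D; lra.
    - intros z hz. apply D; lra.
    - intros z hz. specialize (dE_le z ltac:(lra)).
      pose proof (exp_pos (- (lam * z))). nra. }
  (* At [T] the ratio [y ^ 2 / r] may be [0 / 0], but it is at most [Rabs y]. *)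
  set (psi := fun s => (m * vy s ^ 2 + Rabs (y s)) * exp (- (lam * s))).
  assert (psi_T : psi T = 0).
  { unfold psi. rewrite y0, vy0, Rabs_R0. ring. }
  assert (E_le : forall s, T < s < T' -> E s * exp (- (lam * s)) <= psi s).
  { intros s hs. unfold psi, E. apply Rmult_le_compat_r; [left; apply exp_pos|].
    apply Rplus_le_compat_l. specialize (rpos s hs). specialize (rsq s hs).
    apply Rle_div_l; [assumption|]. rewrite <- (pow2_abs (y s)).
    assert (Rabs (y s) <= r s).
    { unfold r. rewrite <- (sqrt_pow2 (Rabs (y s)) (Rabs_pos _)), pow2_abs.
      apply sqrt_le_1_alt. pose proof (pow2_ge_0 (x s)). lra. }
    pose proof (Rabs_pos (y s)). nra. }
  assert (cpsi : continuous psi T).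
  { unfold psi.
    apply (continuous_mult (fun s => m * vy s ^ 2 + Rabs (y s)) (fun s => exp (- (lam * s)))).
    - apply (continuous_plus (fun s => m * vy s ^ 2) (fun s => Rabs (y s))).
      + apply (continuous_scal_r m (fun s => vy s ^ 2)).
        apply (continuous_comp vy (fun z => z ^ 2)); [apply cvy|].
        apply (ex_derive_continuous (V := R_NormedModule)). auto_derive. easy.
      + apply (continuous_comp y Rabs); [apply cy | apply continuous_Rabs].
    - apply (ex_derive_continuous (V := R_NormedModule)). auto_derive. easy. }
  assert (E_nonpos : E t * exp (- (lam * t)) <= 0).
  { destruct (Rle_dec (E t * exp (- (lam * t))) 0) as [|hpos]; [assumption|exfalso].
    destruct (continuous_near psi T (E t * exp (- (lam * t))) cpsi ltac:(lra)) as [d [hd H]].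
    set (s := Rmin (T + d / 2) ((T + t) / 2)).
    assert (hs1 : s <= T + d / 2) by apply Rmin_l.
    assert (hs2 : s <= (T + t) / 2) by apply Rmin_r.
    assert (hs3 : T < s) by (apply Rmin_glb_lt; lra).
    specialize (H s ltac:(apply Rabs_def1; lra)). rewrite psi_T, Rminus_0_r in H.
    apply Rabs_def2 in H.
    specialize (mono s t ltac:(lra) ltac:(lra) ltac:(lra)).
    specialize (E_le s ltac:(lra)). lra. }
  pose proof (exp_pos (- (lam * t))) as he.
  assert (Et : E t <= 0) by nra.
  unfold E in Et. specialize (rpos t ht).
  set (q := y t ^ 2 / r t) in *.
  assert (hq : q * r t = y t ^ 2) by (unfold q; field; lra).
  assert (q0 : 0 <= q) by (apply Rdiv_le_0_compat; [apply pow2_ge_0 | assumption]).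
  pose proof (pow2_ge_0 (vy t)).
  assert (vy t ^ 2 = 0) by nra.
  assert (q = 0) by nra.
  assert (y t ^ 2 = 0) by (rewrite <- hq, H1; ring).
  split; now apply Rsqr_0_uniq; rewrite Rsqr_pow2.
Qed.

(** The square roots [d2] and [d3] are the distances to the outer holes. Since
    [d2^2 - d3^2 = 4 b y], the difference is [y] times an explicit factor,
    whose absolute value is at most [1 / d2 + 1 / d3]; both distances are at
    least [b / 2]. *)
Lemma transverse_force_bound (b c y d2 d3 : R) :
  0 < b -> 0 <= c -> Rabs y <= b / 2 ->
  d2 = sqrt (c + (b + y) ^ 2) -> d3 = sqrt (c + (b - y) ^ 2) ->
  Rabs ((b + y) / d2 - (b - y) / d3) <= 4 / b * Rabs y.
Proof.
  intros hb hc hy -> ->. apply Rabs_le_between in hy.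
  set (d2 := sqrt (c + (b + y) ^ 2)). set (d3 := sqrt (c + (b - y) ^ 2)).
  assert (s2 : d2 * d2 = c + (b + y) ^ 2) by (apply sqrt_sqrt; nra).
  assert (s3 : d3 * d3 = c + (b - y) ^ 2) by (apply sqrt_sqrt; nra).
  assert (l2 : b + y <= d2).
  { unfold d2. rewrite <- (sqrt_pow2 (b + y)) at 1 by lra. apply sqrt_le_1_alt. lra. }
  assert (l3 : b - y <= d3).
  { unfold d3. rewrite <- (sqrt_pow2 (b - y)) at 1 by lra. apply sqrt_le_1_alt. lra. }
  assert (E : (b + y) / d2 - (b - y) / d3
              = ((d2 + d3 - 4 * b ^ 2 / (d2 + d3)) / (d2 * d3)) * y).
  { assert (H : (d2 - d3) * (d2 + d3) = 4 * b * y) by nra.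
    assert (H' : d3 - d2 = - (4 * b * y) / (d2 + d3)) by (rewrite <- H; field; lra).
    transitivity ((b * (d3 - d2) + y * (d2 + d3)) / (d2 * d3)); [field; lra|].
    rewrite H'. field. lra. }
  rewrite E, Rabs_mult. apply Rmult_le_compat_r; [apply Rabs_pos|].
  assert (p : 0 < d2 * d3) by nra.
  assert (q0 : 0 <= 4 * b ^ 2 / (d2 + d3)) by (apply Rdiv_le_0_compat; nra).
  assert (q1 : 4 * b ^ 2 / (d2 + d3) <= d2 + d3) by (apply Rle_div_l; nra).
  rewrite Rabs_pos_eq by (apply Rdiv_le_0_compat; lra).
  apply Rle_div_l; [assumption|].
  assert (i2 : 2 / b * d2 * d3 >= d3).
  { replace (2 / b * d2 * d3) with (d3 * (d2 / (b / 2))) by (field; lra).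
    assert (1 <= d2 / (b / 2)) by (apply Rle_div_r; lra). nra. }
  assert (i3 : 2 / b * d2 * d3 >= d2).
  { replace (2 / b * d2 * d3) with (d2 * (d3 / (b / 2))) by (field; lra).
    assert (1 <= d3 / (b / 2)) by (apply Rle_div_r; lra). nra. }
  replace (4 / b * (d2 * d3)) with (2 / b * d2 * d3 + 2 / b * d2 * d3) by (field; lra).
  lra.
Qed.

(** * Motion along the axis *)

(** The net force towards [A4] at the point of the axis at distance [x] from
    [A1]; the constant [-1] is the pull of the first string. Taking this pull
    constant also for [x < 0], where it would change sign in the mechanical
    system, makes the force smooth. *)
Definition axial_force (h b w x : R) : R := 2 * w * ((h - x) / sqrt ((h - x) ^ 2 + b ^ 2)) - 1.

Definition potential (h b w x : R) : R := x + 2 * w * sqrt ((h - x) ^ 2 + b ^ 2).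

Lemma side_pos (h b x : R) : 0 < b -> 0 < sqrt ((h - x) ^ 2 + b ^ 2).
Proof.
  intro hb. apply sqrt_lt_R0. pose proof (pow2_ge_0 (h - x)). nra.
Qed.

Lemma side_sqr (h b x : R) :
  sqrt ((h - x) ^ 2 + b ^ 2) * sqrt ((h - x) ^ 2 + b ^ 2) = (h - x) ^ 2 + b ^ 2.
Proof.
  apply sqrt_sqrt. pose proof (pow2_ge_0 (h - x)). pose proof (pow2_ge_0 b). lra.
Qed.

Lemma potential_derive (h b w x : R) :
  0 < b -> is_derive (potential h b w) x (- axial_force h b w x).
Proof.
  intro hb. pose proof (side_pos h b x hb) as hs.
  unfold potential, axial_force. auto_derive.
  - pose proof (pow2_ge_0 (h - x)). simpl in *. nra.
  - replace ((h + - x) * ((h + - x) * 1) + b * (b * 1)) with ((h - x) ^ 2 + b ^ 2) by ring.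
    field. lra.
Qed.

Lemma energy_conservation (h b w m T : R) (x v : R -> R) :
  0 < b -> 0 < m -> 0 <= T ->
  (forall t, continuous x t) -> (forall t, continuous v t) ->
  (forall t, 0 < t < T -> is_derive x t (v t)) ->
  (forall t, 0 < t < T -> is_derive v t (axial_force h b w (x t) / m)) ->
  m / 2 * v T ^ 2 + potential h b w (x T) = m / 2 * v 0 ^ 2 + potential h b w (x 0).
Proof.
  intros hb hm hT cx cv dx dv.
  destruct (Req_dec T 0) as [-> | hT0]; [reflexivity|].
  apply (constant_of_derive (fun t => m / 2 * v t ^ 2 + potential h b w (x t)) (fun _ => 0)).
  - lra.
  - intros t _.
    apply (continuous_plus (fun t => m / 2 * v t ^ 2) (fun t => potential h b w (x t))).
    + apply (continuous_comp v (fun z => m / 2 * z ^ 2)); [apply cv|].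
      apply (ex_derive_continuous (V := R_NormedModule)). auto_derive. easy.
    + apply (continuous_comp x (potential h b w)); [apply cx|].
      eapply continuous_of_derive. now apply potential_derive.
  - intros t ht. specialize (dx t ht). specialize (dv t ht).
    assert (D := is_derive_comp (potential h b w) x t _ _ (potential_derive h b w (x t) hb) dx).
    assert (D' : is_derive (fun t => m / 2 * v t ^ 2) t (v t * axial_force h b w (x t))).
    { auto_derive; [eexists; eauto|]. rewrite (Derive_value v _ _ dv). field. lra. }
    replace 0 with (plus (v t * axial_force h b w (x t)) (scal (v t) (- axial_force h b w (x t)))).
    + now apply (is_derive_plus (V := R_NormedModule)).
    + unfold plus, scal; simpl. unfold mult; simpl. ring.
  - reflexivity.
Qed.

(** The derivative of [(h - x) / d], where [d] is the distance to an outer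
    hole, is [- b^2 / d^3], and [b <= d]. *)
Lemma lipschitz_axial_force (h b w m : R) :
  0 < b -> 0 < w -> 0 < m -> lipschitz (2 * w / (b * m)) (fun x => axial_force h b w x / m).
Proof.
  intros hb hw hm.
  set (df := fun x => - (2 * w * b ^ 2) / (m * sqrt ((h - x) ^ 2 + b ^ 2) ^ 3)).
  assert (D : forall x, is_derive (fun x => axial_force h b w x / m) x (df x)).
  { intro x. pose proof (side_pos h b x hb) as hs. pose proof (side_sqr h b x) as hq.
    unfold axial_force, df. auto_derive.
    - split; [pose proof (pow2_ge_0 (h - x)); simpl in *; nra|].
      split; [|easy]. apply Rgt_not_eq. simpl in hs. exact hs.
    - replace ((h + - x) * ((h + - x) * 1) + b * (b * 1)) with ((h - x) ^ 2 + b ^ 2) by ring.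
      set (d := sqrt ((h - x) ^ 2 + b ^ 2)) in *.
      replace (b ^ 2) with (d * d - (h - x) ^ 2) by (rewrite hq; ring). field. lra. }
  assert (B : forall x, Rabs (df x) <= 2 * w / (b * m)).
  { intro x. pose proof (side_pos h b x hb) as hs. pose proof (side_sqr h b x) as hq.
    unfold df. set (d := sqrt ((h - x) ^ 2 + b ^ 2)) in *.
    assert (hbd : b <= d).
    { unfold d. rewrite <- (sqrt_pow2 b) at 1 by lra. apply sqrt_le_1_alt.
      pose proof (pow2_ge_0 (h - x)). lra. }
    assert (hd3 : b ^ 3 <= d ^ 3) by (apply pow_incr; lra).
    assert (0 < d ^ 3) by (apply pow_lt; assumption).
    replace (- (2 * w * b ^ 2) / (m * d ^ 3)) with (- ((2 * w * b ^ 2) / (m * d ^ 3)))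
      by (field; split; nra).
    rewrite Rabs_Ropp, Rabs_pos_eq.
    - replace (2 * w * b ^ 2 / (m * d ^ 3)) with (2 * w / (b * m) * (b ^ 3 / d ^ 3))
        by (field; repeat split; lra).
      rewrite <- (Rmult_1_r (2 * w / (b * m))) at 2.
      apply Rmult_le_compat_l.
      + apply Rdiv_le_0_compat; nra.
      + apply Rle_div_l; lra.
    - apply Rdiv_le_0_compat; nra. }
  intros x y.
  apply (bounded_variation (fun x => axial_force h b w x / m) df _ y x).
  intros t _. split; [apply D | apply B].
Qed.

Lemma cauchy_schwarz_sqrt (a b c d : R) :
  a * c + b * d <= sqrt (a ^ 2 + b ^ 2) * sqrt (c ^ 2 + d ^ 2).
Proof.
  rewrite <- sqrt_mult_alt by nra.
  apply Rle_trans with (1 := Rle_abs _). rewrite <- sqrt_Rsqr_abs.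
  apply sqrt_le_1_alt. unfold Rsqr. pose proof (pow2_ge_0 (a * d - b * c)). nra.
Qed.

(** The potential is convex and decreasing at [0], so it exceeds its value at
    [0] everywhere on the negative side. Energy conservation therefore
    confines a knot that starts at rest from [0] to the nonnegative side. *)
Lemma nonneg_of_potential_le_start (h b w x : R) :
  0 < b -> 0 < w -> 0 < axial_force h b w 0 ->
  potential h b w x <= potential h b w 0 -> 0 <= x.
Proof.
  intros hb hw hF hU. destruct (Rle_dec 0 x) as [|hn]; [assumption|exfalso].
  unfold potential, axial_force in *.
  pose proof (side_pos h b 0 hb) as p0. pose proof (side_sqr h b 0) as q0.
  pose proof (side_pos h b x hb) as px. pose proof (side_sqr h b x) as qx.
  set (d0 := sqrt ((h - 0) ^ 2 + b ^ 2)) in *.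
  set (d := sqrt ((h - x) ^ 2 + b ^ 2)) in *.
  assert (hF' : d0 < 2 * w * h).
  { replace (2 * w * ((h - 0) / d0)) with (2 * w * h / d0) in hF by (field; lra).
    assert (H : 1 < 2 * w * h / d0) by lra. apply Rlt_div_r in H; lra. }
  (* Cauchy-Schwarz for the vectors from the two positions to a lower hole. *)
  assert (CS : d0 * d0 - h * x <= d * d0).
  { rewrite q0. pose proof (cauchy_schwarz_sqrt (h - x) b (h - 0) b).
    fold d d0 in H. lra. }
  assert (H : d0 * (x + 2 * w * d) <= d0 * (0 + 2 * w * d0)) by (apply Rmult_le_compat_l; lra).
  assert (H' : 2 * w * (d0 * d0 - h * x) <= 2 * w * (d * d0)) by (apply Rmult_le_compat_l; lra).
  nra.
Qed.

(** Below level [c] the speed increases, so it is eventually bounded below by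
    a positive constant and [x] cannot stay under [c]. The speed is still
    increasing up to the first time at which [x] is [c]. *)
Lemma reaches_level (f : R -> R) (m c : R) (x v : R -> R) :
  0 < m -> 0 < c ->
  (forall u, u < c -> 0 < f u) ->
  (forall t, continuous x t) -> (forall t, continuous v t) ->
  (forall t, 0 < t -> is_derive x t (v t)) ->
  (forall t, 0 < t -> is_derive v t (f (x t) / m)) ->
  x 0 = 0 -> v 0 = 0 ->
  exists t0, 0 < t0 /\ x t0 = c /\ (forall t, 0 <= t < t0 -> x t < c) /\ 0 < v t0.
Proof.
  intros hm hc hf cx cv dx dv x0 v0.
  assert (speed : forall s t, 0 <= s < t -> (forall u, s < u < t -> x u < c) -> v s < v t).
  { intros s t hst hb.
    apply (increasing_of_derive v (fun t => f (x t) / m)); [lra | intros; apply cv | |].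
    - intros u hu. apply dv. lra.
    - intros u hu. apply Rdiv_lt_0_compat; [|assumption]. apply hf, hb, hu. }
  assert (hex : exists t1, 0 <= t1 /\ c <= x t1).
  { apply NNPP. intro hno.
    assert (hb : forall t, 0 <= t -> x t < c).
    { intros t ht. apply Rnot_le_lt. intro. apply hno. now exists t. }
    assert (v1 : 0 < v 1).
    { rewrite <- v0. apply speed; [lra|]. intros u hu. apply hb. lra. }
    assert (x1 : x 0 <= x 1).
    { apply (nondecreasing_of_derive x v); [lra | intros; apply cx | |].
      - intros u hu. apply dx. lra.
      - intros u hu. rewrite <- v0. left. apply speed; [lra|]. intros z hz. apply hb. lra. }
    assert (hT : 0 < c / v 1) by now apply Rdiv_lt_0_compat.
    destruct (mean_value_open x v 1 (1 + c / v 1)) as [u [hu E]].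
    - lra.
    - intros; apply cx.
    - intros z hz. apply dx. lra.
    - assert (v 1 < v u) by (apply speed; [lra|]; intros z hz; apply hb; lra).
      specialize (hb (1 + c / v 1) ltac:(lra)).
      replace (1 + c / v 1 - 1) with (c / v 1) in E by ring.
      assert (v 1 * (c / v 1) <= v u * (c / v 1)) by (apply Rmult_le_compat_r; lra).
      replace (v 1 * (c / v 1)) with c in H0 by (field; lra). lra. }
  destruct hex as [t1 [ht1 hx1]].
  destruct (first_hitting_time x c t1 cx ltac:(lra) ht1 hx1) as [t0 [h0 [h1 h2]]].
  exists t0. repeat split; try assumption.
  rewrite <- v0. apply speed; [lra|]. intros u hu. apply h2. lra.
Qed.

(** * Motions in the plane stay on the axis *)

(** The coordinates of a motion in the frame of the triangle, with the values
    at negative times chosen so as to be continuous on the whole line. The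
    conditionals give the force of the first string at [A1]. *)
Record planar_motion (h b w m : R) (x y vx vy wx wy : R -> R) : Prop := {
  x_continuous : forall t, continuous x t;
  y_continuous : forall t, continuous y t;
  vx_continuous : forall t, continuous vx t;
  vy_continuous : forall t, continuous vy t;
  wx_continuous : forall t, continuous wx t;
  wy_continuous : forall t, continuous wy t;
  x_derive : forall t, 0 < t -> is_derive x t (vx t);
  y_derive : forall t, 0 < t -> is_derive y t (vy t);
  vx_derive : forall t, 0 < t -> is_derive vx t (wx t);
  vy_derive : forall t, 0 < t -> is_derive vy t (wy t);
  x_start : x 0 = 0;
  y_start : y 0 = 0;
  vx_start : vx 0 = 0;
  vy_start : vy 0 = 0;
  x_equation : forall t, 0 <= t ->
    m * wx t = (if Req_dec_T (sqrt (x t ^ 2 + y t ^ 2)) 0 then -1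
                else - x t / sqrt (x t ^ 2 + y t ^ 2))
               + w * ((h - x t) / sqrt ((h - x t) ^ 2 + (b + y t) ^ 2)
                      + (h - x t) / sqrt ((h - x t) ^ 2 + (b - y t) ^ 2));
  y_equation : forall t, 0 <= t ->
    m * wy t = (if Req_dec_T (sqrt (x t ^ 2 + y t ^ 2)) 0 then 0
                else - y t / sqrt (x t ^ 2 + y t ^ 2))
               + w * (- (b + y t) / sqrt ((h - x t) ^ 2 + (b + y t) ^ 2)
                      + (b - y t) / sqrt ((h - x t) ^ 2 + (b - y t) ^ 2))
}.

Arguments x_continuous {h b w m x y vx vy wx wy} _ _.
Arguments y_continuous {h b w m x y vx vy wx wy} _ _.
Arguments vx_continuous {h b w m x y vx vy wx wy} _ _.
Arguments vy_continuous {h b w m x y vx vy wx wy} _ _.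
Arguments wx_continuous {h b w m x y vx vy wx wy} _ _.
Arguments wy_continuous {h b w m x y vx vy wx wy} _ _.
Arguments x_derive {h b w m x y vx vy wx wy} _ _ _.
Arguments y_derive {h b w m x y vx vy wx wy} _ _ _.
Arguments vx_derive {h b w m x y vx vy wx wy} _ _ _.
Arguments vy_derive {h b w m x y vx vy wx wy} _ _ _.
Arguments x_equation {h b w m x y vx vy wx wy} _ _ _.
Arguments y_equation {h b w m x y vx vy wx wy} _ _ _.
Arguments x_start {h b w m x y vx vy wx wy} _.
Arguments y_start {h b w m x y vx vy wx wy} _.
Arguments vx_start {h b w m x y vx vy wx wy} _.
Arguments vy_start {h b w m x y vx vy wx wy} _.

Section PlanarMotion.
Context (h b w m : R) (x y vx vy wx wy : R -> R).
Context (hb : 0 < b) (hw : 0 < w) (hm : 0 < m).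
Context (M : planar_motion h b w m x y vx vy wx wy).

Lemma axial_equation (t : R) :
  0 <= t -> y t = 0 -> 0 <= x t -> wx t = axial_force h b w (x t) / m.
Proof.
  intros ht hy hx. assert (E := x_equation M t ht).
  rewrite hy in E. rewrite Rplus_0_r, Rminus_0_r in E.
  replace (x t ^ 2 + 0 ^ 2) with (x t ^ 2) in E by ring.
  rewrite (sqrt_pow2 _ hx) in E.
  unfold axial_force. apply (Rmult_eq_reg_l m); [|lra].
  set (c := (h - x t) / sqrt ((h - x t) ^ 2 + b ^ 2)) in *.
  replace (m * ((2 * w * c - 1) / m)) with (2 * w * c - 1) by (field; lra).
  rewrite E. destruct (Req_dec_T (x t) 0); [ring|].
  replace (- x t / x t) with (-1) by now field. ring.
Qed.

(** At [A1] the first string pulls along the axis, and the transverse pulls of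
    the two outer strings cancel. *)
Lemma transverse_equation_at_start (t : R) :
  0 <= t -> x t = 0 -> y t = 0 -> wy t = 0.
Proof.
  intros ht hx hy. assert (E := y_equation M t ht).
  rewrite hx, hy in E. rewrite Rplus_0_r, !Rminus_0_r in E.
  replace (0 ^ 2 + 0 ^ 2) with 0 in E by ring. rewrite sqrt_0 in E.
  destruct (Req_dec_T 0 0) as [_|]; [|easy].
  apply (Rmult_eq_reg_l m); [|lra]. rewrite E. unfold Rdiv. ring.
Qed.

(** Instance of [singular_gronwall], where [N] is the transverse force of the
    two outer strings. The radius [x T + 1 + b] only has to bound the distance
    to [A1]. *)
Lemma axis_extension (T K d : R) :
  0 <= T -> 0 <= K -> y T = 0 -> vy T = 0 ->
  (forall s, T < s < T + d -> 0 < x s) ->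
  (forall s, T < s < T + d -> Rabs (y s) <= b / 2) ->
  (forall s, T < s < T + d -> x s < x T + 1) ->
  (forall s, T < s < T + d ->
     0 <= x s * vx s + y s * vy s + K * (x s ^ 2 + y s ^ 2)) ->
  0 <= x T ->
  forall s, T < s < T + d -> y s = 0 /\ vy s = 0.
Proof.
  intros hT hK yT vyT hx hy hx' hrad hxT.
  set (N := fun s => w * (- (b + y s) / sqrt ((h - x s) ^ 2 + (b + y s) ^ 2)
                      + (b - y s) / sqrt ((h - x s) ^ 2 + (b - y s) ^ 2))).
  apply (singular_gronwall m (w * (4 / b)) (x T + 1 + b) K T (T + d) x y vx vy wy N).
  - assumption.
  - apply Rmult_le_pos; [lra|]. apply Rdiv_le_0_compat; lra.
  - lra.
  - assumption.
  - apply (y_continuous M).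
  - apply (vy_continuous M).
  - assumption.
  - assumption.
  - intros s hs. apply (x_derive M). lra.
  - intros s hs. apply (y_derive M). lra.
  - intros s hs. apply (vy_derive M). lra.
  - intros s hs. specialize (hx s hs). specialize (hx' s hs). specialize (hy s hs).
    apply Rabs_le_between in hy. split; nra.
  - assumption.
  - intros s hs. rewrite (y_equation M) by lra.
    specialize (hx s hs).
    destruct (Req_dec_T (sqrt (x s ^ 2 + y s ^ 2)) 0) as [e|_]; [exfalso|reflexivity].
    apply sqrt_eq_0 in e; nra.
  - intros s hs. unfold N. rewrite Rabs_mult, (Rabs_pos_eq w), Rmult_assoc by lra.
    apply Rmult_le_compat_l; [lra|].
    replace (- (b + y s) / sqrt ((h - x s) ^ 2 + (b + y s) ^ 2)
             + (b - y s) / sqrt ((h - x s) ^ 2 + (b - y s) ^ 2))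
      with (- ((b + y s) / sqrt ((h - x s) ^ 2 + (b + y s) ^ 2)
             - (b - y s) / sqrt ((h - x s) ^ 2 + (b - y s) ^ 2))) by (unfold Rdiv; ring).
    rewrite Rabs_Ropp.
    apply (transverse_force_bound b ((h - x s) ^ 2)); try easy; [apply pow2_ge_0|].
    now apply hy.
Qed.

(** Away from [A1] the distance to [A1] is bounded below and its derivative is
    bounded, so the constant [K] of [singular_gronwall] exists by continuity. *)
Lemma axis_extension_regular (T : R) :
  0 <= T -> y T = 0 -> vy T = 0 -> 0 < x T ->
  exists d, 0 < d /\ forall s, T < s < T + d -> y s = 0 /\ vy s = 0 /\ 0 <= x s.
Proof.
  intros hT yT vyT xT.
  (* At [T] this makes [x vx + y vy + K r^2] at least [1]. *)
  set (K := (Rabs (x T * vx T) + 1) / x T ^ 2).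
  assert (hx2 : 0 < x T ^ 2) by (apply pow_lt; assumption).
  assert (hK : 0 <= K).
  { apply Rdiv_le_0_compat; [pose proof (Rabs_pos (x T * vx T)); lra | assumption]. }
  assert (cx := x_continuous M T).
  assert (cy := y_continuous M T).
  assert (cvx := vx_continuous M T).
  assert (cvy := vy_continuous M T).
  assert (cr : continuous (fun s => x s * vx s + y s * vy s + K * (x s ^ 2 + y s ^ 2)) T).
  { apply (continuous_plus (fun s => x s * vx s + y s * vy s) (fun s => K * (x s ^ 2 + y s ^ 2))).
    - apply (continuous_plus (fun s => x s * vx s) (fun s => y s * vy s)).
      + now apply (continuous_mult x vx).
      + now apply (continuous_mult y vy).
    - apply (continuous_scal_r K (fun s => x s ^ 2 + y s ^ 2)).
      apply (continuous_plus (fun s => x s ^ 2) (fun s => y s ^ 2)).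
      + apply (continuous_comp x (fun z => z ^ 2)); [assumption|].
        apply (ex_derive_continuous (V := R_NormedModule)). auto_derive. easy.
      + apply (continuous_comp y (fun z => z ^ 2)); [assumption|].
        apply (ex_derive_continuous (V := R_NormedModule)). auto_derive. easy. }
  assert (pr : 0 < x T * vx T + y T * vy T + K * (x T ^ 2 + y T ^ 2)).
  { rewrite yT, vyT. replace (K * (x T ^ 2 + 0 ^ 2)) with (Rabs (x T * vx T) + 1)
      by (unfold K; field; lra).
    pose proof (Rabs_maj2 (x T * vx T)). lra. }
  destruct (locally_interval _ T (positive_near x T cx xT)) as [d1 [hd1 H1]].
  destruct (locally_interval _ T (positive_near _ T cr pr)) as [d2 [hd2 H2]].
  destruct (continuous_near x T 1 cx Rlt_0_1) as [d3 [hd3 H3]].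
  destruct (continuous_near y T (b / 2) cy ltac:(lra)) as [d4 [hd4 H4]].
  rewrite yT in H4.
  set (d := Rmin (Rmin d1 d2) (Rmin d3 d4)).
  assert (hd : d <= d1 /\ d <= d2 /\ d <= d3 /\ d <= d4).
  { unfold d. pose proof (Rmin_l (Rmin d1 d2) (Rmin d3 d4)).
    pose proof (Rmin_r (Rmin d1 d2) (Rmin d3 d4)).
    pose proof (Rmin_l d1 d2). pose proof (Rmin_r d1 d2).
    pose proof (Rmin_l d3 d4). pose proof (Rmin_r d3 d4). lra. }
  assert (dpos : 0 < d) by (unfold d; repeat apply Rmin_pos; assumption).
  exists d. split; [assumption|].
  assert (X : forall s, T < s < T + d -> 0 < x s) by (intros s hs; apply H1; lra).
  assert (Y := axis_extension T K d hT hK yT vyT X).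
  intros s hs. specialize (X s hs).
  destruct (fun A B C => Y A B C (Rlt_le _ _ xT) s hs) as [Y1 Y2]; [| | |repeat split; lra].
  - intros u hu. specialize (H4 u ltac:(apply Rabs_def1; lra)).
    rewrite Rminus_0_r in H4. lra.
  - intros u hu. specialize (H3 u ltac:(apply Rabs_def1; lra)).
    apply Rabs_def2 in H3. lra.
  - intros u hu. left. apply H2. lra.
Qed.

(** At rest at [A1] the acceleration is axial and positive. Hence [wx + wy]
    and [wx - wy] are positive nearby, and integrating twice, so are [x + y]
    and [x - y]. This gives [Rabs y < x] and [Rabs vy < vx], so the distance
    to [A1] increases and [K = 0] is allowed in [singular_gronwall]. *)
Lemma axis_extension_singular (T : R) :
  0 < axial_force h b w 0 ->
  0 <= T -> y T = 0 -> vy T = 0 -> x T = 0 -> vx T = 0 ->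
  exists d, 0 < d /\ forall s, T < s < T + d -> y s = 0 /\ vy s = 0 /\ 0 <= x s.
Proof.
  intros hF hT yT vyT xT vxT.
  assert (cx := x_continuous M).
  assert (cy := y_continuous M).
  assert (cvx := vx_continuous M).
  assert (cvy := vy_continuous M).
  assert (cwx := wx_continuous M).
  assert (cwy := wy_continuous M).
  assert (dx := x_derive M).
  assert (dy := y_derive M).
  assert (dvx := vx_derive M).
  assert (dvy := vy_derive M).
  assert (Wx : 0 < wx T).
  { rewrite axial_equation by lra. rewrite xT. now apply Rdiv_lt_0_compat. }
  assert (Wy : wy T = 0) by now apply transverse_equation_at_start.
  destruct (locally_interval _ T (positive_near (fun s => wx s + wy s) T
    (continuous_plus wx wy T (cwx T) (cwy T)) ltac:(lra))) as [d1 [hd1 H1]].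
  destruct (locally_interval _ T (positive_near (fun s => wx s - wy s) T
    (continuous_minus wx wy T (cwx T) (cwy T)) ltac:(lra))) as [d2 [hd2 H2]].
  destruct (continuous_near x T 1 (cx T) Rlt_0_1) as [d3 [hd3 H3]].
  destruct (continuous_near y T (b / 2) (cy T) ltac:(lra)) as [d4 [hd4 H4]].
  rewrite yT in H4.
  set (d := Rmin (Rmin d1 d2) (Rmin d3 d4)).
  assert (hd : d <= d1 /\ d <= d2 /\ d <= d3 /\ d <= d4).
  { unfold d. pose proof (Rmin_l (Rmin d1 d2) (Rmin d3 d4)).
    pose proof (Rmin_r (Rmin d1 d2) (Rmin d3 d4)).
    pose proof (Rmin_l d1 d2). pose proof (Rmin_r d1 d2).
    pose proof (Rmin_l d3 d4). pose proof (Rmin_r d3 d4). lra. }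
  assert (dpos : 0 < d) by (unfold d; repeat apply Rmin_pos; assumption).
  assert (V1 : forall s, T < s < T + d -> 0 < vx s + vy s).
  { intros s hs. replace 0 with (vx T + vy T) by lra.
    apply (increasing_of_derive (fun s => vx s + vy s) (fun s => wx s + wy s)); [lra| | |].
    - intros u _. apply (continuous_plus vx vy); [apply cvx | apply cvy].
    - intros u hu. apply (is_derive_plus vx vy); [apply dvx; lra | apply dvy; lra].
    - intros u hu. apply H1. lra. }
  assert (V2 : forall s, T < s < T + d -> 0 < vx s - vy s).
  { intros s hs. replace 0 with (vx T - vy T) by lra.
    apply (increasing_of_derive (fun s => vx s - vy s) (fun s => wx s - wy s)); [lra| | |].
    - intros u _. apply (continuous_minus vx vy); [apply cvx | apply cvy].
    - intros u hu. apply (is_derive_minus vx vy); [apply dvx; lra | apply dvy; lra].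
    - intros u hu. apply H2. lra. }
  assert (X1 : forall s, T < s < T + d -> 0 < x s + y s).
  { intros s hs. replace 0 with (x T + y T) by lra.
    apply (increasing_of_derive (fun s => x s + y s) (fun s => vx s + vy s)); [lra| | |].
    - intros u _. apply (continuous_plus x y); [apply cx | apply cy].
    - intros u hu. apply (is_derive_plus x y); [apply dx; lra | apply dy; lra].
    - intros u hu. apply V1. lra. }
  assert (X2 : forall s, T < s < T + d -> 0 < x s - y s).
  { intros s hs. replace 0 with (x T - y T) by lra.
    apply (increasing_of_derive (fun s => x s - y s) (fun s => vx s - vy s)); [lra| | |].
    - intros u _. apply (continuous_minus x y); [apply cx | apply cy].
    - intros u hu. apply (is_derive_minus x y); [apply dx; lra | apply dy; lra].
    - intros u hu. apply V2. lra. }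
  exists d. split; [assumption|].
  assert (X : forall s, T < s < T + d -> 0 < x s).
  { intros s hs. specialize (X1 s hs). specialize (X2 s hs). lra. }
  assert (Y := axis_extension T 0 d hT (Rle_refl 0) yT vyT X).
  intros s hs. specialize (X s hs).
  destruct (fun A B C => Y A B C (Req_le_sym _ _ xT) s hs) as [Y1 Y2]; [| | |repeat split; lra].
  - intros u hu. specialize (H4 u ltac:(apply Rabs_def1; lra)).
    rewrite Rminus_0_r in H4. lra.
  - intros u hu. specialize (H3 u ltac:(apply Rabs_def1; lra)).
    apply Rabs_def2 in H3. lra.
  - intros u hu. specialize (X1 u hu). specialize (X2 u hu).
    specialize (V1 u hu). specialize (V2 u hu). nra.
Qed.

(** The three properties are propagated together: [y = 0] and [0 <= x] up to
    time [T] give conservation of the axial energy, which shows that the knot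
    is at rest if it is at [A1] at time [T]; this is what the continuation
    beyond [T] requires. *)
Lemma stays_on_axis :
  0 < axial_force h b w 0 ->
  forall t, 0 <= t -> y t = 0 /\ vy t = 0 /\ 0 <= x t.
Proof.
  intro hF.
  assert (cx := x_continuous M).
  assert (cy := y_continuous M).
  assert (cvy := vy_continuous M).
  assert (zero_limit : forall (f : R -> R) T, continuous f T -> 0 < T ->
            (forall s, 0 <= s < T -> f s = 0) -> f T = 0).
  { intros f T cf hT hf.
    assert (0 <= f T) by (apply (nonneg_left_limit f); auto; intros s hs; rewrite hf; lra).
    assert (0 <= - f T); [|lra].
    apply (nonneg_left_limit (fun s => - f s)); auto.
    - now apply (continuous_opp f).
    - intros s hs. rewrite hf; lra. }
  apply real_induction.
  - intros T hT hbelow. destruct (Req_dec T 0) as [-> | hT0].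
    + rewrite (y_start M), (vy_start M),
        (x_start M). lra.
    + split; [|split].
      * apply zero_limit; [apply cy | lra |]. intros s hs. now apply hbelow.
      * apply zero_limit; [apply cvy | lra |]. intros s hs. now apply hbelow.
      * apply nonneg_left_limit; [apply cx | lra |]. intros s hs. now apply hbelow.
  - intros T hT hupto. destruct (hupto T ltac:(lra)) as [yT [vyT xT]].
    destruct (Req_dec (x T) 0) as [x0 | xne].
    + apply axis_extension_singular; try assumption.
      assert (En := energy_conservation h b w m T x vx hb hm hT cx
        (vx_continuous M)
        (fun t ht => x_derive M t (proj1 ht))).
      rewrite (vx_start M), (x_start M), x0 in En.
      assert (H : m / 2 * vx T ^ 2 = 0).
      { apply (Rplus_eq_reg_r (potential h b w 0)). rewrite En; [ring|].
        intros t ht. destruct (hupto t ltac:(lra)) as [yt [_ xt]].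
        rewrite <- axial_equation by lra. apply (vx_derive M). lra. }
      assert (vx T ^ 2 = 0) by nra.
      apply Rsqr_0_uniq. now rewrite Rsqr_pow2.
    + apply axis_extension_regular; try assumption. lra.
Qed.

End PlanarMotion.

(** * Coordinates adapted to the triangle *)

Lemma eucl_dist_sqrt (P Q : R * R) :
  eucl_dist P Q = sqrt ((fst Q - fst P) ^ 2 + (snd Q - snd P) ^ 2).
Proof.
  unfold eucl_dist, norm; simpl. unfold prod_norm. f_equal.
  unfold norm; simpl. unfold abs; simpl. unfold minus, plus, opp; simpl.
  pose proof (pow2_abs (fst Q - fst P)) as H1. pose proof (pow2_abs (snd Q - snd P)) as H2.
  simpl in H1, H2. unfold Rminus in *. rewrite H1, H2. reflexivity.
Qed.

Definition orthonormal (e n : R * R) : Prop :=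
  fst e ^ 2 + snd e ^ 2 = 1 /\ fst n ^ 2 + snd n ^ 2 = 1 /\ dot e n = 0.

Definition frame_point (A e n : R * R) (x y : R) : R * R :=
  (fst A + x * fst e + y * fst n, snd A + x * snd e + y * snd n).

Lemma frame_point_origin (A e n : R * R) : frame_point A e n 0 0 = A.
Proof.
  destruct A. unfold frame_point; simpl. f_equal; ring.
Qed.

(** The column relations of the orthogonal matrix with rows [e] and [n]: its
    determinant [D] satisfies [D * D = 1], and [n] is [D] times the quarter
    turn of [e]. *)
Lemma orthonormal_swap (e n : R * R) :
  orthonormal e n ->
  fst e ^ 2 + fst n ^ 2 = 1 /\ snd e ^ 2 + snd n ^ 2 = 1 /\ fst e * snd e + fst n * snd n = 0.
Proof.
  destruct e as [e1 e2], n as [n1 n2]. intros [He [Hn Hd]]. unfold dot in Hd. simpl in *.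
  set (D := e1 * n2 - e2 * n1).
  assert (HD : D * D = 1).
  { replace (D * D) with ((e1 * (e1 * 1) + e2 * (e2 * 1)) * (n1 * (n1 * 1) + n2 * (n2 * 1))
      - (e1 * n1 + e2 * n2) * (e1 * n1 + e2 * n2)) by (unfold D; ring).
    rewrite He, Hn, Hd. ring. }
  assert (H1 : n1 = - D * e2).
  { replace (- D * e2) with (n1 * (e1 * (e1 * 1) + e2 * (e2 * 1)) - e1 * (e1 * n1 + e2 * n2))
      by (unfold D; ring). rewrite He, Hd. ring. }
  assert (H2 : n2 = D * e1).
  { replace (D * e1) with (n2 * (e1 * (e1 * 1) + e2 * (e2 * 1)) - e2 * (e1 * n1 + e2 * n2))
      by (unfold D; ring). rewrite He, Hd. ring. }
  rewrite H1, H2. repeat split.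
  - replace (e1 * (e1 * 1) + - D * e2 * (- D * e2 * 1)) with (e1 * e1 + D * D * (e2 * e2)) by ring.
    rewrite HD. lra.
  - replace (e2 * (e2 * 1) + D * e1 * (D * e1 * 1)) with (e2 * e2 + D * D * (e1 * e1)) by ring.
    rewrite HD. lra.
  - replace (e1 * e2 + - D * e2 * (D * e1)) with (e1 * e2 * (1 - D * D)) by ring.
    rewrite HD. ring.
Qed.

Lemma frame_point_coordinates (A e n P : R * R) :
  orthonormal e n ->
  P = frame_point A e n (dot (minus P A) e) (dot (minus P A) n).
Proof.
  intro H. destruct (orthonormal_swap e n H) as [H1 [H2 H3]].
  destruct A as [a1 a2], e as [e1 e2], n as [n1 n2], P as [p1 p2].
  unfold frame_point, dot, minus, plus, opp; simpl in *. unfold prod_plus, prod_opp; simpl.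
  unfold plus, opp; simpl.
  f_equal.
  - transitivity (a1 + (p1 - a1) * (e1 * (e1 * 1) + n1 * (n1 * 1))
                     + (p2 - a2) * (e1 * e2 + n1 * n2)); [rewrite H1, H3|]; ring.
  - transitivity (a2 + (p2 - a2) * (e2 * (e2 * 1) + n2 * (n2 * 1))
                     + (p1 - a1) * (e1 * e2 + n1 * n2)); [rewrite H2, H3|]; ring.
Qed.

Lemma dot_minus_frame_point (A e n : R * R) (x y x' y' : R) :
  orthonormal e n ->
  dot (minus (frame_point A e n x' y') (frame_point A e n x y)) e = x' - x /\
  dot (minus (frame_point A e n x' y') (frame_point A e n x y)) n = y' - y.
Proof.
  destruct A as [a1 a2], e as [e1 e2], n as [n1 n2]. intros [He [Hn Hd]].
  unfold frame_point, dot, minus, plus, opp in *; simpl in *. unfold prod_plus, prod_opp; simpl.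
  unfold plus, opp; simpl. split.
  - transitivity ((x' - x) * (e1 * (e1 * 1) + e2 * (e2 * 1)) + (y' - y) * (e1 * n1 + e2 * n2));
      [ring | rewrite He, Hd; ring].
  - transitivity ((x' - x) * (e1 * n1 + e2 * n2) + (y' - y) * (n1 * (n1 * 1) + n2 * (n2 * 1)));
      [ring | rewrite Hn, Hd; ring].
Qed.

Lemma dot_frame_point (A e n : R * R) (x y x1 y1 x2 y2 : R) :
  orthonormal e n ->
  dot (minus (frame_point A e n x1 y1) (frame_point A e n x y))
      (minus (frame_point A e n x2 y2) (frame_point A e n x y))
  = (x1 - x) * (x2 - x) + (y1 - y) * (y2 - y).
Proof.
  intro H. destruct (dot_minus_frame_point A e n x y x1 y1 H) as [H1 H2].
  rewrite <- H1, <- H2 at 1.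
  set (u := minus (frame_point A e n x1 y1) (frame_point A e n x y)).
  destruct A as [a1 a2], e as [e1 e2], n as [n1 n2], u as [u1 u2].
  unfold frame_point, dot, minus, plus, opp in *; simpl in *. unfold prod_plus, prod_opp; simpl.
  unfold plus, opp; simpl. ring.
Qed.

Lemma eucl_dist_frame_point (A e n : R * R) (x y x' y' : R) :
  orthonormal e n ->
  eucl_dist (frame_point A e n x y) (frame_point A e n x' y')
  = sqrt ((x' - x) ^ 2 + (y' - y) ^ 2).
Proof.
  intro H. rewrite eucl_dist_sqrt. f_equal.
  assert (E := dot_frame_point A e n x y x' y' x' y' H).
  replace ((x' - x) ^ 2 + (y' - y) ^ 2) with ((x' - x) * (x' - x) + (y' - y) * (y' - y)) by ring.
  rewrite <- E. unfold dot, minus, plus, opp; simpl. unfold plus, opp; simpl. ring.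
Qed.

Lemma dot_plus (u v e : R * R) : dot (plus u v) e = dot u e + dot v e.
Proof.
  destruct u, v, e. unfold dot, plus; simpl. unfold plus; simpl. ring.
Qed.

Lemma dot_scal (k : R) (u e : R * R) : dot (scal k u) e = k * dot u e.
Proof.
  destruct u, e. unfold dot, scal; simpl. unfold scal, mult; simpl. unfold mult; simpl. ring.
Qed.

Lemma unit_vector_frame_point (A e n : R * R) (x y x' y' : R) :
  orthonormal e n ->
  dot (unit_vector (frame_point A e n x y) (frame_point A e n x' y')) e
    = (x' - x) / sqrt ((x' - x) ^ 2 + (y' - y) ^ 2) /\
  dot (unit_vector (frame_point A e n x y) (frame_point A e n x' y')) n
    = (y' - y) / sqrt ((x' - x) ^ 2 + (y' - y) ^ 2).
Proof.
  intro H. unfold unit_vector. rewrite eucl_dist_frame_point by assumption.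
  destruct (dot_minus_frame_point A e n x y x' y' H) as [H1 H2].
  split.
  - rewrite dot_scal, H1. unfold Rdiv. ring.
  - rewrite dot_scal, H2. unfold Rdiv. ring.
Qed.

(** The median from [A1] is orthogonal to [A2 A3] because [A1 A2 = A1 A3];
    noncollinearity makes [h] and [b] positive. *)
Lemma isosceles_frame (A1 A2 A3 A4 : R * R) (a : R) :
  ~ collinear A1 A2 A3 -> eucl_dist A1 A2 = a -> eucl_dist A1 A3 = a ->
  A4 = midpoint A2 A3 ->
  exists (e n : R * R) (h b : R),
    orthonormal e n /\ 0 < h /\ 0 < b /\ a = sqrt (h ^ 2 + b ^ 2) /\
    A2 = frame_point A1 e n h (- b) /\ A3 = frame_point A1 e n h b /\
    A4 = frame_point A1 e n h 0.
Proof.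
  rewrite !eucl_dist_sqrt. unfold collinear, midpoint.
  destruct A1 as [x1 y1], A2 as [x2 y2], A3 as [x3 y3], A4 as [x4 y4].
  cbn [fst snd]. intros hnc h12 h13 h4.
  assert (E4x : x4 = / 2 * (x2 + x3)) by exact (f_equal fst h4).
  assert (E4y : y4 = / 2 * (y2 + y3)) by exact (f_equal snd h4). clear h4.
  set (E1 := x4 - x1). set (E2 := y4 - y1). set (N1 := x3 - x4). set (N2 := y3 - y4).
  assert (X2 : x2 = x1 + E1 - N1) by (unfold E1, N1; lra).
  assert (Y2 : y2 = y1 + E2 - N2) by (unfold E2, N2; lra).
  assert (X3 : x3 = x1 + E1 + N1) by (unfold E1, N1; lra).
  assert (Y3 : y3 = y1 + E2 + N2) by (unfold E2, N2; lra).
  assert (X4 : x4 = x1 + E1) by (unfold E1; lra).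
  assert (Y4 : y4 = y1 + E2) by (unfold E2; lra).
  clearbody E1 E2 N1 N2. clear E4x E4y.
  assert (nn : forall u v : R, 0 <= u ^ 2 + v ^ 2).
  { intros u v. pose proof (pow2_ge_0 u). pose proof (pow2_ge_0 v). lra. }
  assert (perp : E1 * N1 + E2 * N2 = 0).
  { rewrite <- h13 in h12. apply sqrt_inj in h12; [|apply nn|apply nn].
    rewrite X2, Y2, X3, Y3 in h12. lra. }
  assert (cross : E1 * N2 - E2 * N1 <> 0).
  { intro c. apply hnc. rewrite X2, Y2, X3, Y3.
    transitivity (2 * (E1 * N2 - E2 * N1)); [ring | rewrite c; ring]. }
  assert (pE : 0 < E1 ^ 2 + E2 ^ 2).
  { pose proof (pow2_ge_0 E1). pose proof (pow2_ge_0 E2).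
    destruct (Req_dec (E1 ^ 2 + E2 ^ 2) 0) as [z|]; [|lra].
    exfalso. assert (E1 = 0) by nra. assert (E2 = 0) by nra. apply cross. rewrite H1, H2. ring. }
  assert (pN : 0 < N1 ^ 2 + N2 ^ 2).
  { pose proof (pow2_ge_0 N1). pose proof (pow2_ge_0 N2).
    destruct (Req_dec (N1 ^ 2 + N2 ^ 2) 0) as [z|]; [|lra].
    exfalso. assert (N1 = 0) by nra. assert (N2 = 0) by nra. apply cross. rewrite H1, H2. ring. }
  set (h := sqrt (E1 ^ 2 + E2 ^ 2)). set (b := sqrt (N1 ^ 2 + N2 ^ 2)).
  assert (hpos : 0 < h) by now apply sqrt_lt_R0.
  assert (bpos : 0 < b) by now apply sqrt_lt_R0.
  assert (hh : h * h = E1 ^ 2 + E2 ^ 2) by (apply sqrt_sqrt; lra).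
  assert (bb : b * b = N1 ^ 2 + N2 ^ 2) by (apply sqrt_sqrt; lra).
  exists (E1 / h, E2 / h), (N1 / b, N2 / b), h, b.
  unfold orthonormal, frame_point, dot; simpl.
  repeat split.
  - transitivity ((E1 ^ 2 + E2 ^ 2) / (h * h)); [field; lra | rewrite hh; field; lra].
  - transitivity ((N1 ^ 2 + N2 ^ 2) / (b * b)); [field; lra | rewrite bb; field; lra].
  - transitivity ((E1 * N1 + E2 * N2) / (h * b)); [field; lra | rewrite perp; field; lra].
  - assumption.
  - assumption.
  - rewrite <- h13. f_equal. rewrite X3, Y3.
    transitivity ((E1 ^ 2 + E2 ^ 2) + (N1 ^ 2 + N2 ^ 2) + 2 * (E1 * N1 + E2 * N2)); [ring|].
    rewrite <- hh, <- bb, perp. ring.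
  - rewrite X2, Y2. f_equal; field; lra.
  - rewrite X3, Y3. f_equal; field; lra.
  - rewrite X4, Y4. f_equal; field; lra.
Qed.

Lemma angle_on_axis (A e n : R * R) (h b x : R) :
  orthonormal e n -> 0 < b -> x < h ->
  angle (frame_point A e n h 0) (frame_point A e n x 0) (frame_point A e n h b)
  = acos ((h - x) / sqrt ((h - x) ^ 2 + b ^ 2)).
Proof.
  intros H hb hx. unfold angle.
  rewrite dot_frame_point, !eucl_dist_frame_point by assumption.
  replace ((h - x) ^ 2 + (0 - 0) ^ 2) with ((h - x) ^ 2) by ring.
  rewrite sqrt_pow2 by lra. rewrite !Rminus_0_r.
  pose proof (side_pos h b x hb). f_equal. field. lra.
Qed.

Lemma axis_cosine_bounds (h b x : R) :
  0 < b -> x < h -> 0 < (h - x) / sqrt ((h - x) ^ 2 + b ^ 2) < 1.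
Proof.
  intros hb hx. pose proof (side_pos h b x hb). pose proof (side_sqr h b x).
  split; [apply Rdiv_lt_0_compat; lra|]. apply Rlt_div_l; [assumption|].
  rewrite Rmult_1_l. apply Rsqr_incrst_0; [unfold Rsqr; nra | lra | lra].
Qed.

Lemma sin_angle_on_axis (A e n : R * R) (h b x : R) :
  orthonormal e n -> 0 < b -> x < h ->
  sin (angle (frame_point A e n h 0) (frame_point A e n x 0) (frame_point A e n h b))
  = b / sqrt ((h - x) ^ 2 + b ^ 2).
Proof.
  intros H hb hx. rewrite angle_on_axis by assumption.
  pose proof (axis_cosine_bounds h b x hb hx).
  pose proof (side_pos h b x hb). pose proof (side_sqr h b x).
  rewrite sin_acos by lra. set (d := sqrt ((h - x) ^ 2 + b ^ 2)) in *.
  replace (1 - ((h - x) / d)²) with ((b / d) ^ 2).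
  - apply sqrt_pow2. apply Rdiv_le_0_compat; lra.
  - unfold Rsqr. assert (E : b ^ 2 = d * d - (h - x) ^ 2) by (rewrite H2; ring).
    transitivity (b ^ 2 / (d * d)); [field; lra | rewrite E; field; lra].
Qed.

(** With [phi] the angle on the left, [2 phi < acos z] gives [z < cos (2 phi)
    = 2 (cos phi)^2 - 1], that is [1 < 4 w^2 (cos phi)^2], and [cos phi = h /
    sqrt (h^2 + b^2)]. *)
Lemma pull_of_angle (h b w : R) :
  0 < h -> 0 < b -> 0 < w ->
  acos (h / sqrt (h ^ 2 + b ^ 2)) < 1 / 2 * acos (1 / (2 * w ^ 2) - 1) ->
  sqrt (h ^ 2 + b ^ 2) < 2 * w * h.
Proof.
  intros hh hb hw hphi.
  assert (B := axis_cosine_bounds h b 0 hb hh). rewrite Rminus_0_r in B.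
  set (a := sqrt (h ^ 2 + b ^ 2)) in *.
  assert (ha : 0 < a) by (apply sqrt_lt_R0; nra).
  set (phi := acos (h / a)) in *. set (z := 1 / (2 * w ^ 2) - 1) in *.
  pose proof (acos_bound (h / a)) as P1. fold phi in P1.
  pose proof (acos_bound z) as P2.
  assert (hw2 : 0 < 2 * w ^ 2) by nra.
  assert (z1 : -1 < z).
  { unfold z. assert (0 < 1 / (2 * w ^ 2)) by (apply Rdiv_lt_0_compat; lra). lra. }
  (* For [1 <= z] the clipped [acos z] is [0], and [phi] is not negative. *)
  assert (z2 : z < 1).
  { apply Rnot_le_lt. intro hz.
    assert (acos z = 0); [|lra].
    unfold acos. destruct (Rle_dec z (-1)); [lra|]. destruct (Rle_dec 1 z); [easy|lra]. }
  assert (C : z < cos (2 * phi)).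
  { rewrite <- (cos_acos z) at 1 by lra. apply cos_decreasing_1; lra. }
  rewrite cos_2a_cos in C. unfold phi in C. rewrite cos_acos in C by lra.
  unfold z in C.
  assert (C' : 1 / (2 * w ^ 2) < 2 * (h / a) * (h / a)) by lra.
  apply (Rlt_div_l 1 _ (2 * w ^ 2) hw2) in C'.
  apply Rsqr_incrst_0; [unfold Rsqr | lra | nra].
  assert (D : 2 * (h / a) * (h / a) * (2 * w ^ 2) = (2 * w * h) * (2 * w * h) / (a * a))
    by (field; lra).
  rewrite D in C'. apply Rlt_div_r in C'; [lra | nra].
Qed.

(** * The point where the axial force vanishes *)

(** The solution [x < h] of [2 w (h - x) = sqrt ((h - x)^2 + b^2)]; the square
    root is a genuine one only for [1 / 2 < w]. *)
Definition equilibrium (h b w : R) : R := h - b / sqrt (4 * w ^ 2 - 1).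

Lemma equilibrium_spec (h b w : R) :
  0 < h -> 0 < b -> 0 < w -> sqrt (h ^ 2 + b ^ 2) < 2 * w * h ->
  0 < equilibrium h b w < h /\
  sqrt ((h - equilibrium h b w) ^ 2 + b ^ 2) = 2 * w * (h - equilibrium h b w).
Proof.
  intros hh hb hw hpull.
  assert (H : h ^ 2 + b ^ 2 < (2 * w * h) ^ 2).
  { rewrite <- (pow2_sqrt (h ^ 2 + b ^ 2)) by nra.
    pose proof (sqrt_pos (h ^ 2 + b ^ 2)). nra. }
  assert (k0 : 0 < 4 * w ^ 2 - 1).
  { apply Rnot_le_lt. intro. assert (0 < b ^ 2) by nra. nra. }
  unfold equilibrium. set (k := sqrt (4 * w ^ 2 - 1)).
  assert (kp : 0 < k) by now apply sqrt_lt_R0.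
  assert (kk : k * k = 4 * w ^ 2 - 1) by (apply sqrt_sqrt; lra).
  assert (q0 : 0 < b / k) by now apply Rdiv_lt_0_compat.
  assert (q1 : b / k < h).
  { apply Rlt_div_l; [assumption|]. apply Rsqr_incrst_0; [unfold Rsqr; nra | lra | nra]. }
  split; [lra|]. replace (h - (h - b / k)) with (b / k) by ring.
  replace ((b / k) ^ 2 + b ^ 2) with ((2 * w * (b / k)) ^ 2).
  - apply sqrt_pow2. nra.
  - transitivity (4 * w ^ 2 * b ^ 2 / (k * k)); [field; lra|].
    replace (4 * w ^ 2) with (1 + k * k) by lra. field. lra.
Qed.

Lemma axial_force_pos (h b w x : R) :
  0 < b -> 0 < w -> 0 < equilibrium h b w < h ->
  sqrt ((h - equilibrium h b w) ^ 2 + b ^ 2) = 2 * w * (h - equilibrium h b w) ->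
  x < equilibrium h b w -> 0 < axial_force h b w x.
Proof.
  intros hb hw [c0 ch] hc hx. set (c := equilibrium h b w) in *.
  pose proof (side_pos h b x hb). pose proof (side_sqr h b x).
  pose proof (side_sqr h b c). rewrite hc in H1.
  unfold axial_force. set (d := sqrt ((h - x) ^ 2 + b ^ 2)) in *.
  assert (d < 2 * w * (h - x)).
  { apply Rsqr_incrst_0; [unfold Rsqr | lra | nra].
    assert ((h - c) ^ 2 < (h - x) ^ 2) by nra.
    assert (k : 0 < 4 * w ^ 2 - 1).
    { apply Rnot_le_lt. intro. assert (0 < b ^ 2) by nra.
      assert (0 <= (h - c) ^ 2) by nra. nra. }
    assert ((4 * w ^ 2 - 1) * (h - c) ^ 2 < (4 * w ^ 2 - 1) * (h - x) ^ 2)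
      by (apply Rmult_lt_compat_l; assumption).
    nra. }
  replace (2 * w * ((h - x) / d)) with (2 * w * (h - x) / d) by (field; lra).
  assert (1 < 2 * w * (h - x) / d); [|lra]. apply Rlt_div_r; lra.
Qed.

(** Bound below each of the three distances from a point [P] to the holes by
    the scalar product with the unit vector from the equilibrium to that hole.
    The weighted sum of these three vectors vanishes, so the sum of the bounds
    does not depend on [P], and for [P] at the equilibrium they are
    equalities. *)
Lemma equilibrium_is_FT_point (A e n O : R * R) (h b w : R) :
  orthonormal e n -> 0 < b -> 0 < w -> 0 < equilibrium h b w < h ->
  sqrt ((h - equilibrium h b w) ^ 2 + b ^ 2) = 2 * w * (h - equilibrium h b w) ->
  is_weighted_FT_point A (frame_point A e n h (- b)) (frame_point A e n h b) 1 w w O ->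
  O = frame_point A e n (equilibrium h b w) 0.
Proof.
  intros H hb hw [c0 ch] hc [_ hu]. apply hu. clear hu. intro P.
  rewrite (frame_point_coordinates A e n P H).
  set (x := dot (minus P A) e). set (y := dot (minus P A) n). clearbody x y.
  set (c := equilibrium h b w) in *.
  unfold weighted_dist_sum.
  assert (dA : forall u v, eucl_dist (frame_point A e n u v) A
                           = sqrt ((0 - u) ^ 2 + (0 - v) ^ 2)).
  { intros u v. rewrite <- (eucl_dist_frame_point A e n u v 0 0 H), frame_point_origin.
    reflexivity. }
  rewrite !dA, !eucl_dist_frame_point by assumption.
  pose proof (cauchy_schwarz_sqrt (0 - x) (0 - y) (-1) 0) as C1.
  pose proof (cauchy_schwarz_sqrt (h - x) (- b - y) (h - c) (- b)) as C2.
  pose proof (cauchy_schwarz_sqrt (h - x) (b - y) (h - c) b) as C3.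
  pose proof (side_sqr h b c) as S. rewrite hc in S.
  replace ((h - c) ^ 2 + (- b) ^ 2) with ((h - c) ^ 2 + b ^ 2) in C2 by ring.
  rewrite hc in C2, C3.
  replace ((-1) ^ 2 + 0 ^ 2) with 1 in C1 by ring. rewrite sqrt_1 in C1.
  replace ((0 - c) ^ 2 + (0 - 0) ^ 2) with (c ^ 2) by ring. rewrite sqrt_pow2 by lra.
  replace ((h - c) ^ 2 + (- b - 0) ^ 2) with ((h - c) ^ 2 + b ^ 2) by ring.
  replace ((h - c) ^ 2 + (b - 0) ^ 2) with ((h - c) ^ 2 + b ^ 2) by ring.
  rewrite hc.
  set (d1 := sqrt ((0 - x) ^ 2 + (0 - y) ^ 2)) in *.
  set (d2 := sqrt ((h - x) ^ 2 + (- b - y) ^ 2)) in *.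
  set (d3 := sqrt ((h - x) ^ 2 + (b - y) ^ 2)) in *.
  assert (Hq : 0 < h - c) by lra. set (q := h - c) in *.
  assert (K : (h - x) * q * 2 + 2 * b ^ 2 <= 2 * q * (w * d2 + w * d3)) by lra.
  replace (b ^ 2) with (2 * w * q * (2 * w * q) - q ^ 2) in K by (rewrite S; ring).
  assert (K' : q * (2 * (h - x) + 2 * (4 * w ^ 2 * q - q)) <= q * (2 * (w * d2 + w * d3))) by lra.
  apply Rmult_le_reg_l in K'; [|assumption]. unfold q in *. lra.
Qed.

(** * Passing between motions and their coordinates *)

(** Extending by the value at [0] turns one-sided continuity into continuity
    on the whole line, for which composition lemmas apply directly. *)
Lemma continuous_of_half_line (U : UniformSpace) (f : R -> U) :
  continuous_on (fun t => 0 <= t) f -> forall t, continuous (fun s => f (Rmax 0 s)) t.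
Proof.
  intros hf t. unfold continuous.
  apply (filterlim_comp _ _ _ (Rmax 0) f _ (within (fun s => 0 <= s) (locally (Rmax 0 t)))).
  - intros Q [d hd]. exists d. intros s hs. apply hd; [|apply Rmax_l].
    change (Rabs (Rmax 0 s - Rmax 0 t) < d). change (Rabs (s - t) < d) in hs.
    apply Rabs_def2 in hs. unfold Rmax.
    destruct (Rle_dec 0 s), (Rle_dec 0 t); apply Rabs_def1; lra.
  - apply hf. apply Rmax_l.
Qed.

Lemma half_line_interior (t : R) :
  0 < t -> filter_le (locally t) (within (fun s => 0 <= s) (locally t)).
Proof.
  intros ht Q hQ. unfold within in hQ.
  assert (D : locally t (fun s => 0 <= s)).
  { apply (filter_imp (fun s => 0 < s)); [intros; lra|]. now apply (open_gt 0). }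
  generalize (filter_and _ _ hQ D). apply filter_imp. intuition.
Qed.

Lemma continuous_on_of_derivative (f f' : R -> R * R) :
  is_derivative_nonneg f f' -> continuous_on (fun t => 0 <= t) f.
Proof.
  intros hf t ht.
  assert (FF : Filter (within (fun s => 0 <= s) (locally t))) by apply within_filter, locally_filter.
  apply (filterdiff_continuous_aux f).
  - eexists. apply hf. assumption.
  - intros Q hQ. apply (filter_le_within (F := locally t)). exact hQ.
Qed.

Lemma is_derive_interior (f f' : R -> R * R) (t : R) :
  is_derivative_nonneg f f' -> 0 < t -> is_derive f t (f' t).
Proof.
  intros hf ht. destruct (hf t (Rlt_le _ _ ht)) as [hl hd]. split; [exact hl|].
  intros x hx.
  apply (is_domin_le (F := within (fun s => 0 <= s) (locally t))).
  - apply hd. intros Q hQ. apply (filter_le_within (F := locally t)). now apply hx.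
  - now apply half_line_interior.
Qed.

(** The definition of a derivative along a filter quantifies over all limit
    points of the filter; on the half-line only [t] is one. *)
Lemma is_derivative_nonneg_of_derive (f f' : R -> R * R) :
  (forall t, 0 <= t -> is_derive f t (f' t)) -> is_derivative_nonneg f f'.
Proof.
  intros hf t ht. destruct (hf t ht) as [hl hd]. split; [exact hl|].
  intros x hx.
  assert (x = t) as ->.
  { apply NNPP. intro hne.
    assert (hp : 0 < Rabs (t - x)) by (apply Rabs_pos_lt; lra).
    destruct (hx (ball x (Rabs (t - x)))) as [d H].
    - exists (mkposreal _ hp). intros s hs. exact hs.
    - specialize (H t (ball_center t d) ht). change (Rabs (t - x) < Rabs (t - x)) in H. lra. }
  apply (is_domin_le (F := locally t)).
  - apply hd. intros Q hQ. exact hQ.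
  - apply (filter_le_within (F := locally t)).
Qed.

Lemma is_linear_dot (e : R * R) : is_linear (fun u : R * R => dot u e).
Proof.
  apply (is_linear_ext (fun u : R * R => plus (scal (fst e) (fst u)) (scal (snd e) (snd u)))).
  - intro u. unfold dot, plus, scal; simpl. unfold mult; simpl. ring.
  - apply (is_linear_comp (fun u : R * R => (scal (fst e) (fst u), scal (snd e) (snd u)))
             (fun z => plus (fst z) (snd z))).
    + apply is_linear_prod.
      * apply (is_linear_comp (fun z : R * R => fst z) (fun z : R => scal (fst e) z));
          [apply is_linear_fst|].
        apply (is_linear_scal_r (V := R_NormedModule) (fst e)). apply Rmult_comm.
      * apply (is_linear_comp (fun z : R * R => snd z) (fun z : R => scal (snd e) z));
          [apply is_linear_snd|].
        apply (is_linear_scal_r (V := R_NormedModule) (snd e)). apply Rmult_comm.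
    + apply is_linear_plus.
Qed.

Lemma is_derive_dot (f : R -> R * R) (t : R) (l e : R * R) :
  is_derive f t l -> is_derive (fun s => dot (f s) e) t (dot l e).
Proof.
  intro hf.
  assert (H := filterdiff_comp f (fun u => dot u e) _ _ hf
                 (filterdiff_linear _ (is_linear_dot e))).
  apply (filterdiff_ext_lin _ _ _ H). intro h. apply (dot_scal h l e).
Qed.

Lemma first_string_coordinates (A e n : R * R) (c x y : R) :
  orthonormal e n -> 0 < c ->
  let F := first_string_direction A (frame_point A e n c 0) (frame_point A e n x y) in
  let r := sqrt (x ^ 2 + y ^ 2) in
  dot F e = (if Req_dec_T r 0 then -1 else - x / r) /\
  dot F n = (if Req_dec_T r 0 then 0 else - y / r).
Proof.
  intros H hc F r.
  assert (U : forall u v,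
    dot (unit_vector (frame_point A e n u v) A) e = - u / sqrt (u ^ 2 + v ^ 2) /\
    dot (unit_vector (frame_point A e n u v) A) n = - v / sqrt (u ^ 2 + v ^ 2)).
  { intros u v. destruct (unit_vector_frame_point A e n u v 0 0 H) as [U1 U2].
    rewrite frame_point_origin in U1, U2. rewrite U1, U2.
    replace ((0 - u) ^ 2 + (0 - v) ^ 2) with (u ^ 2 + v ^ 2) by ring.
    unfold Rdiv. split; ring. }
  assert (R0 : eucl_dist (frame_point A e n x y) A = r).
  { rewrite <- (frame_point_origin A e n) at 2. rewrite eucl_dist_frame_point by assumption.
    unfold r. f_equal. ring. }
  unfold F, first_string_direction. rewrite R0.
  destruct (Req_dec_T r 0).
  - destruct (U c 0) as [U1 U2]. rewrite U1, U2.
    replace (c ^ 2 + 0 ^ 2) with (c ^ 2) by ring. rewrite sqrt_pow2 by lra.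
    split; field; lra.
  - apply U.
Qed.

Lemma planar_motion_of_tree (A e n : R * R) (h b w m c : R) (P : R -> R * R) :
  orthonormal e n -> 0 < c ->
  oscillatory_FT_tree A (frame_point A e n h (- b)) (frame_point A e n h b) 1 w w m
    (frame_point A e n c 0) P ->
  exists x y vx vy wx wy,
    planar_motion h b w m x y vx vy wx wy /\
    forall t, 0 <= t -> P t = frame_point A e n (x t) (y t).
Proof.
  intros H hc (V & W & dP & dV & cW & P0 & V0 & eqn).
  assert (cP := continuous_of_half_line _ _ (continuous_on_of_derivative _ _ dP)).
  assert (cV := continuous_of_half_line _ _ (continuous_on_of_derivative _ _ dV)).
  assert (cW' := continuous_of_half_line _ _ cW).
  assert (at_nonneg : forall t, 0 <= t -> Rmax 0 t = t) by (intros; now apply Rmax_right).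
  assert (dot_continuous : forall (f : R -> R * R) u t, continuous (fun s => f (Rmax 0 s)) t ->
            continuous (fun s => dot (f (Rmax 0 s)) u) t).
  { intros f u t hf. apply (continuous_comp (fun s => f (Rmax 0 s)) (fun z => dot z u)).
    - exact hf.
    - exact (linear_cont _ _ (is_linear_dot u)). }
  assert (dot_derive : forall (f f' : R -> R * R) u t, is_derivative_nonneg f f' -> 0 < t ->
            is_derive (fun s => dot (f (Rmax 0 s)) u) t (dot (f' (Rmax 0 t)) u)).
  { intros f f' u t hf ht. rewrite at_nonneg by lra.
    apply (is_derive_ext_loc (fun s => dot (f s) u)).
    - apply (filter_imp (fun s => 0 < s)); [|now apply (open_gt 0)].
      intros s hs. rewrite at_nonneg by lra. reflexivity.
    - apply is_derive_dot. now apply is_derive_interior. }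
  assert (dminus : forall z u, dot (minus z A) u = dot z u - dot A u).
  { intros z u. destruct z, A, u. unfold dot, minus, plus, opp; simpl.
    unfold plus, opp; simpl. ring. }
  assert (coords := fun t => frame_point_coordinates A e n (P t) H).
  assert (force : forall t, 0 <= t -> forall u,
    m * dot (W t) u = 1 * dot (first_string_direction A (frame_point A e n c 0) (P t)) u
      + (w * dot (unit_vector (P t) (frame_point A e n h (- b))) u
         + w * dot (unit_vector (P t) (frame_point A e n h b)) u)).
  { intros t ht u. destruct (eqn t ht) as [_ [_ E]].
    apply (f_equal (fun z => dot z u)) in E.
    rewrite !dot_plus, !dot_scal in E. exact E. }
  assert (coord_continuous : forall (f : R -> R * R) u t, continuous (fun s => f (Rmax 0 s)) t ->
            continuous (fun s => dot (minus (f (Rmax 0 s)) A) u) t).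
  { intros f u t hf. apply (continuous_ext (fun s => dot (f (Rmax 0 s)) u - dot A u)).
    - intro s. symmetry. apply dminus.
    - apply (continuous_minus (fun s => dot (f (Rmax 0 s)) u) (fun _ => dot A u)).
      + now apply dot_continuous.
      + apply continuous_const. }
  assert (coord_derive : forall u t, 0 < t ->
            is_derive (fun s => dot (minus (P (Rmax 0 s)) A) u) t (dot (V (Rmax 0 t)) u)).
  { intros u t ht. apply (is_derive_ext (fun s => dot (P (Rmax 0 s)) u - dot A u)).
    - intro s. symmetry. apply dminus.
    - rewrite <- (Rminus_0_r (dot (V (Rmax 0 t)) u)).
      apply (is_derive_minus (fun s => dot (P (Rmax 0 s)) u) (fun _ => dot A u)).
      + now apply dot_derive.
      + apply (is_derive_const (V := R_NormedModule)). }
  exists (fun t => dot (minus (P (Rmax 0 t)) A) e), (fun t => dot (minus (P (Rmax 0 t)) A) n),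
    (fun t => dot (V (Rmax 0 t)) e), (fun t => dot (V (Rmax 0 t)) n),
    (fun t => dot (W (Rmax 0 t)) e), (fun t => dot (W (Rmax 0 t)) n).
  split; [|intros t ht; rewrite at_nonneg by assumption; apply coords].
  constructor.
  - intro t. apply coord_continuous, cP.
  - intro t. apply coord_continuous, cP.
  - intro t. apply dot_continuous, cV.
  - intro t. apply dot_continuous, cV.
  - intro t. apply dot_continuous, cW'.
  - intro t. apply dot_continuous, cW'.
  - intro t. apply coord_derive.
  - intro t. apply coord_derive.
  - intro t. now apply dot_derive.
  - intro t. now apply dot_derive.
  - rewrite at_nonneg, P0, dminus by lra. ring.
  - rewrite at_nonneg, P0, dminus by lra. ring.
  - rewrite at_nonneg, V0 by lra. transitivity (0 * fst e + 0 * snd e); [reflexivity | ring].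
  - rewrite at_nonneg, V0 by lra. transitivity (0 * fst n + 0 * snd n); [reflexivity | ring].
  - intros t ht. rewrite at_nonneg by assumption. rewrite (force t ht e), (coords t).
    set (x := dot (minus (P t) A) e). set (y := dot (minus (P t) A) n).
    destruct (dot_minus_frame_point A e n 0 0 x y H) as [X Y].
    rewrite frame_point_origin, !Rminus_0_r in X, Y. rewrite X, Y.
    destruct (first_string_coordinates A e n c x y H hc) as [F _]. rewrite F.
    rewrite (proj1 (unit_vector_frame_point A e n x y h (- b) H)),
      (proj1 (unit_vector_frame_point A e n x y h b H)).
    replace ((- b - y) ^ 2) with ((b + y) ^ 2) by ring. ring.
  - intros t ht. rewrite at_nonneg by assumption. rewrite (force t ht n), (coords t).
    set (x := dot (minus (P t) A) e). set (y := dot (minus (P t) A) n).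
    destruct (dot_minus_frame_point A e n 0 0 x y H) as [X Y].
    rewrite frame_point_origin, !Rminus_0_r in X, Y. rewrite X, Y.
    destruct (first_string_coordinates A e n c x y H hc) as [_ F]. rewrite F.
    rewrite (proj2 (unit_vector_frame_point A e n x y h (- b) H)),
      (proj2 (unit_vector_frame_point A e n x y h b H)).
    replace ((- b - y) ^ 2) with ((b + y) ^ 2) by ring.
    replace (- b - y) with (- (b + y)) by ring. ring.
Qed.

Lemma orthonormal_ext (e n u v : R * R) :
  orthonormal e n -> dot u e = dot v e -> dot u n = dot v n -> u = v.
Proof.
  intros H E N.
  assert (D : forall z : R * R, minus z (0, 0) = z).
  { intros [z1 z2]. unfold minus, plus, opp; simpl. unfold prod_plus, prod_opp, plus, opp; simpl.
    f_equal; ring. }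
  assert (K : forall z : R * R, z = frame_point (0, 0) e n (dot z e) (dot z n)).
  { intro z. rewrite <- (D z) at 2 3. now apply frame_point_coordinates. }
  rewrite (K u), (K v), E, N. reflexivity.
Qed.

(** On the nonnegative side the first string pulls with the constant force of
    [axial_force], also at [A1] by the convention for its direction there, and
    the transverse pulls of the outer strings cancel. *)
Lemma tree_of_axial_motion (A e n : R * R) (h b w m c : R) (x v : R -> R) :
  orthonormal e n -> 0 < b -> 0 < m -> 0 < c ->
  x 0 = 0 -> v 0 = 0 ->
  (forall t, is_derive x t (v t)) ->
  (forall t, is_derive v t (axial_force h b w (x t) / m)) ->
  (forall t, 0 <= t -> 0 <= x t) ->
  oscillatory_FT_tree A (frame_point A e n h (- b)) (frame_point A e n h b) 1 w w m
    (frame_point A e n c 0) (fun t => frame_point A e n (x t) 0).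
Proof.
  intros H hb hm hc x0 v0 dx dv hx.
  assert (dscal : forall (B : R * R) f f', (forall t, is_derive f t (f' t)) ->
    forall t, is_derive (fun s => frame_point B e n (f s) 0) t (scal (f' t) e : R * R)).
  { intros B f f' hf t.
    apply (is_derive_ext (fun s => plus B (scal (f s) e : R * R))).
    - intro s. unfold frame_point, plus, scal; simpl.
      unfold prod_plus, prod_scal, plus, scal, mult; simpl.
      unfold mult; simpl. f_equal; ring.
    - rewrite <- (plus_zero_l (scal (f' t) e : R * R)).
      apply (is_derive_plus (fun _ => B) (fun s => scal (f s) e : R * R)).
      + apply (is_derive_const (B : prod_NormedModule R_AbsRing R_NormedModule R_NormedModule)).
      + apply (is_derive_scal_l f t (f' t) (e : prod_NormedModule _ R_NormedModule R_NormedModule)). apply hf. }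
  assert (scalE : forall k, frame_point (0, 0) e n k 0 = (scal k e : R * R)).
  { intro k. unfold frame_point, scal; simpl. unfold prod_scal, scal, mult; simpl.
    unfold mult; simpl. f_equal; ring. }
  set (F := fun t => axial_force h b w (x t) / m).
  exists (fun t => scal (v t) e), (fun t => scal (F t) e).
  split; [|split; [|split; [|split; [|split]]]].
  - apply is_derivative_nonneg_of_derive. intros t _. now apply dscal.
  - apply is_derivative_nonneg_of_derive. intros t _.
    apply (is_derive_ext (fun s => frame_point (0, 0) e n (v s) 0)).
    + intro s. apply scalE.
    + now apply dscal.
  - apply continuous_on_forall. intros t _.
    apply (continuous_scal_l F (e : prod_NormedModule _ R_NormedModule R_NormedModule)).
    apply (continuous_comp x (fun z => axial_force h b w z / m)).
    + eapply continuous_of_derive. apply dx.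
    + apply (ex_derive_continuous (V := R_NormedModule)). unfold axial_force.
      pose proof (side_pos h b (x t) hb) as hs. pose proof (pow2_ge_0 (h - x t)).
      auto_derive. simpl in *. split; [nra|]. split; [apply Rgt_not_eq; exact hs | easy].
  - rewrite x0. apply frame_point_origin.
  - rewrite v0. apply (scal_zero_l (e : prod_NormedModule _ R_NormedModule R_NormedModule)).
  - intros t ht. split; [|split].
    + intro E. apply (f_equal (fun z => dot (minus z A) n)) in E.
      destruct (dot_minus_frame_point A e n 0 0 (x t) 0 H) as [_ E1].
      destruct (dot_minus_frame_point A e n 0 0 h (- b) H) as [_ E2].
      rewrite frame_point_origin in E1, E2. lra.
    + intro E. apply (f_equal (fun z => dot (minus z A) n)) in E.
      destruct (dot_minus_frame_point A e n 0 0 (x t) 0 H) as [_ E1].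
      destruct (dot_minus_frame_point A e n 0 0 h b H) as [_ E2].
      rewrite frame_point_origin in E1, E2. lra.
    + specialize (hx t ht). pose proof (side_pos h b (x t) hb) as hs.
      destruct (first_string_coordinates A e n c (x t) 0 H hc) as [Fe Fn].
      replace (x t ^ 2 + 0 ^ 2) with (x t ^ 2) in Fe, Fn by ring.
      rewrite sqrt_pow2 in Fe, Fn by assumption.
      destruct H as [He [Hn Hd]].
      assert (dee : dot e e = 1) by (unfold dot; rewrite <- He; ring).
      assert (den : dot e n = 0) by exact Hd.
      apply (orthonormal_ext e n); [now repeat split| |].
      * rewrite !dot_plus, !dot_scal, dee, Fe.
        rewrite (proj1 (unit_vector_frame_point A e n (x t) 0 h (- b) (conj He (conj Hn Hd)))),
          (proj1 (unit_vector_frame_point A e n (x t) 0 h b (conj He (conj Hn Hd)))).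
        replace ((- b - 0) ^ 2) with (b ^ 2) by ring. rewrite !Rminus_0_r.
        unfold F, axial_force.
        set (z := (h - x t) / sqrt ((h - x t) ^ 2 + b ^ 2)).
        transitivity (2 * w * z - 1); [field; lra|].
        destruct (Req_dec_T (x t) 0); [ring|].
        replace (- x t / x t) with (-1) by now field. ring.
      * rewrite !dot_plus, !dot_scal, den, Fn.
        rewrite (proj2 (unit_vector_frame_point A e n (x t) 0 h (- b) (conj He (conj Hn Hd)))),
          (proj2 (unit_vector_frame_point A e n (x t) 0 h b (conj He (conj Hn Hd)))).
        replace ((- b - 0) ^ 2) with (b ^ 2) by ring. rewrite !Rminus_0_r.
        destruct (Req_dec_T (x t) 0); [|unfold Rdiv]; field; repeat split; try lra.
Qed.

(** * The oscillatory Fermat-Torricelli tree *)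

Theorem theorem2 :
  forall (A1 A2 A3 A4 O : R * R) (a w1 w2 w3 m0 phi0 : R),
    ~ collinear A1 A2 A3 ->
    eucl_dist A1 A2 = a ->
    eucl_dist A1 A3 = a ->
    w1 = 1 ->
    w2 = w3 ->
    0 < w3 ->
    A4 = midpoint A2 A3 ->
    phi0 = angle A4 A1 A3 ->
    phi0 < 1 / 2 * acos (1 / (2 * w2 ^ 2) - 1) ->
    is_weighted_FT_point A1 A2 A3 w1 w2 w3 O ->
    0 < m0 ->
    (exists P : R -> R * R, oscillatory_FT_tree A1 A2 A3 w1 w2 w3 m0 O P) /\
    (forall P : R -> R * R,
       oscillatory_FT_tree A1 A2 A3 w1 w2 w3 m0 O P ->
       (forall t : R, 0 <= t -> on_line A1 O (P t)) /\
       exists t0 : R,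
         0 < t0 /\
         P t0 = O /\
         (forall t : R, 0 <= t < t0 -> P t <> O) /\
         let x := fun t : R => eucl_dist A1 (P t) in
         let v := sqrt (2 / m0 *
                    (2 * a * w2 - x t0
                     - 2 * a * w2 * sin phi0 / sin (angle A4 O A3))) in
         is_derive x t0 v /\ v <> 0).
Proof.
  intros A1 A2 A3 A4 O a w1 w2 w m phi0 hnc h12 h13 -> -> hw hA4 hphi hangle hO hm.
  destruct (isosceles_frame A1 A2 A3 A4 a hnc h12 h13 hA4)
    as (e & n & h & b & H & hh & hb & ha & E2 & E3 & E4).
  clear hnc h12 h13 hA4. subst A2 A3 A4.
  assert (cosphi : phi0 = acos (h / sqrt (h ^ 2 + b ^ 2))).
  { rewrite hphi. rewrite <- (frame_point_origin A1 e n) at 2.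
    rewrite angle_on_axis, Rminus_0_r by assumption. reflexivity. }
  assert (sinphi : sin phi0 = b / a).
  { rewrite hphi. rewrite <- (frame_point_origin A1 e n) at 2.
    rewrite sin_angle_on_axis, Rminus_0_r, ha by assumption. reflexivity. }
  rewrite cosphi in hangle. apply pull_of_angle in hangle; try assumption.
  destruct (equilibrium_spec h b w hh hb hw hangle) as [hc hd].
  assert (EO := equilibrium_is_FT_point A1 e n O h b w H hb hw hc hd hO).
  assert (force := fun x => axial_force_pos h b w x hb hw hc hd).
  set (c := equilibrium h b w) in *. subst O.
  assert (force0 : 0 < axial_force h b w 0) by (apply force; lra).
  split.
  - assert (hL : 0 < 2 * w / (b * m)) by (apply Rdiv_lt_0_compat; nra).
    destruct (second_order_existence _ _ hL (lipschitz_axial_force h b w m hb hw hm))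
      as (x & v & x0 & v0 & dx & dv).
    exists (fun t => frame_point A1 e n (x t) 0).
    apply (tree_of_axial_motion A1 e n h b w m c x v); try assumption; [lra|].
    intros t ht. apply (nonneg_of_potential_le_start h b w); try assumption.
    assert (En : m / 2 * v t ^ 2 + potential h b w (x t)
                 = m / 2 * v 0 ^ 2 + potential h b w (x 0)).
    { apply energy_conservation; try assumption.
      - intro s. eapply continuous_of_derive. apply dx.
      - intro s. eapply continuous_of_derive. apply dv.
      - intros s _. apply dx.
      - intros s _. apply dv. }
    rewrite v0, x0 in En. pose proof (pow2_ge_0 (v t)).
    assert (0 <= m / 2 * v t ^ 2) by nra. lra.
  - intros P hP.
    destruct (planar_motion_of_tree A1 e n h b w m c P H (proj1 hc) hP)
      as (x & y & vx & vy & wx & wy & M & HP).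
    assert (axis := stays_on_axis h b w m x y vx vy wx wy hb hw hm M force0).
    assert (HP' : forall t, 0 <= t -> P t = frame_point A1 e n (x t) 0).
    { intros t ht. rewrite HP by assumption. now rewrite (proj1 (axis t ht)). }
    assert (dvx : forall t, 0 < t -> is_derive vx t (axial_force h b w (x t) / m)).
    { intros t ht. destruct (axis t (Rlt_le _ _ ht)) as [yt [_ xt]].
      rewrite <- (axial_equation h b w m x y vx vy wx wy hm M t) by lra.
      now apply (vx_derive M). }
    assert (cx := x_continuous M).
    assert (cvx := vx_continuous M).
    assert (dx := x_derive M).
    assert (x0 := x_start M).
    assert (v0 := vx_start M).
    assert (dist : forall t, 0 <= t -> eucl_dist A1 (P t) = x t).
    { intros t ht. rewrite HP' by assumption. rewrite <- (frame_point_origin A1 e n) at 1.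
      rewrite eucl_dist_frame_point by assumption.
      replace ((x t - 0) ^ 2 + (0 - 0) ^ 2) with (x t ^ 2) by ring.
      apply sqrt_pow2. now apply axis. }
    split.
    + intros t ht. exists (x t / c). rewrite HP' by assumption.
      destruct A1 as [a1 a2], e as [e1 e2], n as [n1 n2].
      unfold frame_point, minus, plus, opp, scal; simpl.
      unfold prod_plus, prod_opp, prod_scal, plus, opp, scal; simpl. unfold mult; simpl.
      f_equal; field; lra.
    + destruct (reaches_level (axial_force h b w) m c x vx hm (proj1 hc) force cx cvx dx dvx x0 v0)
        as (t0 & ht0 & xt0 & before & vt0).
      exists t0. split; [assumption|]. split; [|split].
      * rewrite HP' by lra. now rewrite xt0.
      * intros t ht E. specialize (before t ht). rewrite HP' in E by lra.
        apply (f_equal (fun z => dot (minus z A1) e)) in E.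
        destruct (dot_minus_frame_point A1 e n 0 0 (x t) 0 H) as [E1 _].
        destruct (dot_minus_frame_point A1 e n 0 0 c 0 H) as [E2 _].
        rewrite frame_point_origin in E1, E2. lra.
      * cbv beta zeta. rewrite dist, xt0 by lra. rewrite sinphi.
        rewrite sin_angle_on_axis, hd by lra || assumption.
        assert (En := energy_conservation h b w m t0 x vx hb hm (Rlt_le _ _ ht0) cx cvx
          (fun t ht => dx t (proj1 ht)) (fun t ht => dvx t (proj1 ht))).
        rewrite v0, x0, xt0 in En. unfold potential in En.
        rewrite hd, Rminus_0_r, <- ha in En.
        assert (apos : 0 < a) by (rewrite ha; apply sqrt_lt_R0; nra).
        assert (Sq : sqrt (2 / m * (2 * a * w - c - 2 * a * w * (b / a) / (b / (2 * w * (h - c)))))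
                     = vx t0).
        { rewrite <- (sqrt_pow2 (vx t0)) by lra. f_equal.
          replace (2 * a * w * (b / a) / (b / (2 * w * (h - c)))) with (2 * w * (2 * w * (h - c)))
            by (field; repeat split; lra).
          replace (2 * a * w - c - 2 * w * (2 * w * (h - c))) with (m / 2 * vx t0 ^ 2) by lra.
          field. lra. }
        rewrite Sq. split; [|lra].
        apply (is_derive_ext_loc x); [|now apply dx].
        apply (filter_imp (fun s => 0 < s)); [|now apply (open_gt 0)].
        intros s hs. symmetry. apply dist. lra.
Qed.
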